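(* Fix $a>0$ and $b>0$, and let the functions $f_{h;a,b},g_{h;a,b},\ell_{h;a,b},\widetilde\ell_{h;a,b},m_{h;a,b}$ on $(0,\infty)$ be defined by the kernel formulas in the context. If $h\in\mathcal Z_1$, the function $f_{h;a,b}$ solves the Gamma--Stein equation $$bxf'(x)-(x-ab)f(x)=h(x)-\mathcal G_{a,b}h,\qquad x>0.$$ Moreover, $f_{h;a,b}$ and $g_{h;a,b}$ are differentiable on $(0,\infty)$, with $f_{h;a,b}'=g_{h;a,b}$ and $g_{h;a,b}'=\ell_{h;a,b}$. The functions $f_{h;a,b}$, $g_{h;a,b}$, $xg_{h;a,b}$ and $x\ell_{h;a,b}$ (the last two meaning $x\mapsto xg_{h;a,b}(x)$ and $x\mapsto x\ell_{h;a,b}(x)$) are bounded on $(0,\infty)$, hence integrable with respect to $\mathcal G_{u,v}$ for every $u,v>0$. If $h\in\mathcal Z_2$, then, in addition, $\ell_{h;a,b}=\widetilde\ell_{h;a,b}$ on $(0,\infty)$. Moreover, $\ell_{h;a,b}$ is differentiable on $(0,\infty)$, with $\ell_{h;a,b}'=m_{h;a,b}$. The functions $\ell_{h;a,b}$ and $xm_{h;a,b}$ (meaning $x\mapsto xm_{h;a,b}(x)$) are bounded on $(0,\infty)$, hence integrable with respect to $\mathcal G_{u,v}$ for every $u,v>0$.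
   Context: For $a,b>0$, $\mathcal G_{a,b}$ denotes the Gamma distribution with shape $a$ and scale $b$, with density $p_{a,b}(x)=\frac{1}{\Gamma(a)b^a}x^{a-1}e^{-x/b}\mathbf 1_{\{x>0\}}$; $\mathcal G_{a,b}h:=\int_0^\infty h(u)p_{a,b}(u)\,du$. $\mathcal Z_1$ is the class of continuously differentiable $h:(0,\infty)\to\mathbb R$ with $\|h'\|_\infty\le1$; $\mathcal Z_2$ is the class of twice continuously differentiable $h:(0,\infty)\to\mathbb R$ with $\|h''\|_\infty\le1$, where $\|\cdot\|_\infty$ is the supremum norm. A solution of the Gamma--Stein equation is a locally absolutely continuous function $f:(0,\infty)\to\mathbb R$ for which there exists a version of its a.e. derivative $f'$ such that the equation holds for every $x>0$. For $x,y>0$ put $P_{a,b}(x)=\int_0^xp_{a,b}(u)\,du$, $\overline P_{a,b}(x)=\int_x^\infty p_{a,b}(u)\,du$, $\underline{\mathrm P}^1_{a,b}(x)=\int_0^xP_{a,b}(u)\,du$, $\overline{\mathrm P}^1_{a,b}(x)=\int_x^\infty\overline P_{a,b}(u)\,du$, $\underline M_{a,b}(y)=\frac{P_{a,b}(y)}{by\,p_{a,b}(y)}$, $\overline M_{a,b}(y)=\frac{\overline P_{a,b}(y)}{by\,p_{a,b}(y)}$ (these ratios are three times continuously differentiable on $(0,\infty)$). Kernels: for $k\in\{0,1,2\}$, with $M^{(k)}$ the $k$-th derivative, $$K_{a,b}^{k,1}(x,y)=-\overline M_{a,b}^{(k)}(y)\frac{P_{a,b}(x)}{p_{a,b}(x)}\mathbf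 1_{\{x\le y\}}-\underline M_{a,b}^{(k)}(y)\frac{\overline P_{a,b}(x)}{p_{a,b}(x)}\mathbf 1_{\{x>y\}},$$ and for $k\in\{2,3\}$, $$K_{a,b}^{k,2}(x,y)=\overline M_{a,b}^{(k)}(y)\frac{\underline{\mathrm P}^1_{a,b}(x)}{p_{a,b}(x)}\mathbf 1_{\{x\le y\}}-\underline M_{a,b}^{(k)}(y)\frac{\overline{\mathrm P}^1_{a,b}(x)}{p_{a,b}(x)}\mathbf 1_{\{x>y\}}.$$ With $X\sim\mathcal G_{a,b}$ and $x>0$ define, whenever $h$ has the regularity needed for the formula, $f_{h;a,b}(x)=\mathbb E[h'(X)K_{a,b}^{0,1}(X,x)]$, $g_{h;a,b}(x)=\mathbb E[h'(X)K_{a,b}^{1,1}(X,x)]$, $\ell_{h;a,b}(x)=\mathbb E[h'(X)K_{a,b}^{2,1}(X,x)]+\frac{h'(x)}{bx}$, $\widetilde\ell_{h;a,b}(x)=\mathbb E[h''(X)K_{a,b}^{2,2}(X,x)]$, $m_{h;a,b}(x)=\mathbb E[h''(X)K_{a,b}^{3,2}(X,x)]+\frac{h''(x)}{bx}$. The formulas for $f_{h;a,b}$ and $g_{h;a,b}$ require $h$ to be a.e. differentiable; that for $\ell_{h;a,b}$ requires differentiability on $(0,\infty)$; that for $\widetilde\ell_{h;a,b}$ requires $h$ to be twice a.e. differentiable; that for $m_{h;a,b}$ requires twice differentiability on $(0,\infty)$. *)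

(* Defs.v *)
From HB Require Import structures.
From mathcomp Require Import all_boot all_order all_algebra.
From mathcomp Require Import all_classical all_reals all_analysis.

Set Implicit Arguments.
Unset Strict Implicit.
Unset Printing Implicit Defensive.

Import Order.TTheory GRing.Theory Num.Theory.
Import numFieldNormedType.Exports.

Local Open Scope classical_set_scope.
Local Open Scope ring_scope.

(* A function on (0, +oo) is represented by a total function R -> R; only its
   values at positive arguments matter.  In particular, the derivatives
   [derive1 f] and [derive1n n f] are only evaluated at positive points, where
   they depend only on the restriction of f to (0, +oo). *)

Section GammaDistribution.
Context {R : realType}.
Implicit Types (a b c d x y : R) (h f F : R -> R) (k : nat).

Local Notation mu := (@lebesgue_measure R).

Definition Gamma_fun a : R :=
  \int[mu]_(t in `]0, +oo[) (t `^ (a - 1) * expR (- t)).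

Definition gamma_pdf a b : R -> R :=
  (fun x => (Gamma_fun a * b `^ a)^-1 * x `^ (a - 1) * expR (- (x / b)))
    \_ `]0, +oo[.

(* The value of Gamma(a, b) on h, i.e., E[h(X)] for X ~ Gamma(a, b).  As for
   any [Rintegral], the value is meaningful when [gamma_integrable a b h]. *)
Definition gamma_mean a b h : R :=
  \int[mu]_(u in `]0, +oo[) (h u * gamma_pdf a b u).

Definition gamma_integrable a b h : Prop :=
  mu.-integrable `]0, +oo[ (fun u => (h u * gamma_pdf a b u)%:E).

Definition gamma_cdf a b x : R := \int[mu]_(u in `]0, x]) gamma_pdf a b u.

Definition gamma_ccdf a b x : R := \int[mu]_(u in `]x, +oo[) gamma_pdf a b u.

Definition gamma_cdf1 a b x : R := \int[mu]_(u in `]0, x]) gamma_cdf a b u.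

Definition gamma_ccdf1 a b x : R := \int[mu]_(u in `]x, +oo[) gamma_ccdf a b u.

Definition lowerM a b y : R := gamma_cdf a b y / (b * y * gamma_pdf a b y).

Definition upperM a b y : R := gamma_ccdf a b y / (b * y * gamma_pdf a b y).

Definition kernel1 a b k x y : R :=
  - derive1n k (upperM a b) y
    * (gamma_cdf a b x / gamma_pdf a b x) * (x <= y)%R%:R
  - derive1n k (lowerM a b) y
    * (gamma_ccdf a b x / gamma_pdf a b x) * (x > y)%R%:R.

Definition kernel2 a b k x y : R :=
  derive1n k (upperM a b) y
    * (gamma_cdf1 a b x / gamma_pdf a b x) * (x <= y)%R%:R
  - derive1n k (lowerM a b) y
    * (gamma_ccdf1 a b x / gamma_pdf a b x) * (x > y)%R%:R.

Definition stein_f a b h x : R :=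
  gamma_mean a b (fun u => derive1 h u * kernel1 a b 0 u x).

Definition stein_g a b h x : R :=
  gamma_mean a b (fun u => derive1 h u * kernel1 a b 1 u x).

Definition stein_l a b h x : R :=
  gamma_mean a b (fun u => derive1 h u * kernel1 a b 2 u x)
  + derive1 h x / (b * x).

Definition stein_ltilde a b h x : R :=
  gamma_mean a b (fun u => derive1n 2 h u * kernel2 a b 2 u x).

Definition stein_m a b h x : R :=
  gamma_mean a b (fun u => derive1n 2 h u * kernel2 a b 3 u x)
  + derive1n 2 h x / (b * x).

Definition classZ1 h : Prop :=
  forall x, 0 < x ->
    [/\ derivable h x 1, {for x, continuous (derive1 h)} & `|derive1 h x| <= 1].

Definition classZ2 h : Prop :=
  forall x, 0 < x ->
    [/\ derivable h x 1, derivable (derive1 h) x 1,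
        {for x, continuous (derive1n 2 h)} & `|derive1n 2 h x| <= 1].

Definition abs_continuous_itv c d f : Prop :=
  forall e : R, 0 < e -> exists2 del : R, 0 < del &
    forall (n : nat) (u v : 'I_n -> R),
      (forall i, [/\ c <= u i, u i <= v i & v i <= d]) ->
      trivIset setT (fun i => `]u i, v i[%classic) ->
      \sum_(i < n) (v i - u i) < del ->
      \sum_(i < n) `|f (v i) - f (u i)| < e.

Definition loc_abs_continuous_pos f : Prop :=
  forall c d, 0 < c -> c <= d -> abs_continuous_itv c d f.

Definition gamma_stein_solution a b h f : Prop :=
  loc_abs_continuous_pos f /\
  exists2 f' : R -> R,
    {ae mu, forall x, 0 < x -> is_derive x 1 f (f' x)} &
    forall x, 0 < x ->
      b * x * f' x - (x - a * b) * f x = h x - gamma_mean a b h.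

Definition bounded_pos F : Prop := [bounded F x | x in `]0%R, +oo[%classic].

End GammaDistribution.

(* Main.v *)
Require Import Defs.
From HB Require Import structures.
From mathcomp Require Import all_boot all_order all_algebra.
From mathcomp Require Import all_classical all_reals all_analysis.
From mathcomp Require Import measurable_realfun ring lra.
Import Order.TTheory GRing.Theory Num.Theory.
Import numFieldNormedType.Exports.
Local Open Scope classical_set_scope.
Local Open Scope ring_scope.

(* Put w(x) = b x p(x).  If q' = p, the k-th derivative of q / w is
   Q_k / (w (b x)^k), where Q_0 = q, Q_{k+1}' = (k+1) Q_k and Q_{k+1} is given by
   a recursion with polynomial coefficients.  For q = P (resp. q = - Pbar), Q_k is
   k! times the k-fold iterated integral of P from 0 (resp., up to sign, of Pbar
   from infinity), so these derivatives have constant signs; and the recursion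
   yields the Wronskian identities
     Q_{k+1} Qbar_k + Q_k Qbar_{k+1} = k! w (b x)^k.
   Splitting at x, a Stein function is a combination of A = int_0^x h' P and
   B = int_x^oo h' Pbar with coefficients the derivatives of P / w and Pbar / w.
   When differentiating in x, the Wronskian turns the boundary terms into
   h'(x) / (b x).  Since |h'| <= 1, A and B are bounded by Q_1 and Qbar_1, and the
   Wronskian evaluates the resulting bounds of f and x l exactly; for g the bound
   is 2 Q_1 Qbar_1 / (w b x), with Q_1 = O(w b x) at 0 and Qbar_1 = O(p) at
   infinity.  The same argument one order higher, with h'' and the once more
   iterated integrals, gives l and m.  All integrations by parts are obtained by
   comparing two functions that have the same derivative and the same limit at 0
   or at infinity. *)

Set Implicit Arguments.
Unset Strict Implicit.
Unset Printing Implicit Defensive.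

(** * Monotonicity, limits and uniqueness of primitives on the positive half-line *)

Section CalculusOnPositiveReals.
Context {R : realType}.
Implicit Types (f g F G dF phi : R -> R) (x y z : R).
Local Notation mu := (@lebesgue_measure R).

(** Positivity is an open condition, so agreement at positive arguments is agreement near [x]. *)
Lemma eq_is_derive_pos f g x df :
  0 < x -> (forall y, 0 < y -> f y = g y) ->
  is_derive x 1 f df -> is_derive x 1 g df.
Proof.
move=> x0 fg; apply: near_eq_is_derive; near=> y; apply: fg.
by near: y; exact: lt_nbhsr.
Unshelve. all: by end_near. Qed.

Lemma is_derive_continuous f x df : is_derive x 1 f df -> {for x, continuous f}.
Proof. by move=> [fx _]; apply/differentiable_continuous/derivable1_diffP. Qed.

Lemma MVT_pos f (df : R -> R) x y : 0 < x -> x <= y ->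
  (forall z, 0 < z -> is_derive z 1 f (df z)) ->
  exists2 c, x <= c <= y & f y - f x = df c * (y - x).
Proof.
move=> x0 xy fdf.
have pos z : z \in `[x, y] -> 0 < z.
  by rewrite in_itv/= => /andP[+ _]; exact: lt_le_trans.
have [||c cxy fE] := @MVT_segment _ f df x y xy.
- by move=> z zxy; apply/fdf/pos; exact: subset_itv_oo_cc zxy.
- by apply: derivable_within_continuous => z /pos/fdf[].
- by exists c => //; rewrite in_itv in cxy.
Qed.

Lemma nondecreasing_pos F dF :
  (forall z, 0 < z -> is_derive z 1 F (dF z)) ->
  (forall z, 0 < z -> 0 <= dF z) ->
  forall x y, 0 < x -> x <= y -> F x <= F y.
Proof.
move=> FdF dF0 x y x0 xy; have [c /andP[xc cy] FE] := MVT_pos x0 xy FdF.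
rewrite -subr_ge0 FE mulr_ge0 ?subr_ge0// dF0//.
exact: lt_le_trans xc.
Qed.

(** [F] is nondecreasing, so [F x] is at least [F z] for [z] near 0, and these values tend to 0.
    Signs and sizes of the iterated integrals are obtained this way below. *)
Lemma ge0_cvg_right0 F dF :
  (forall z, 0 < z -> is_derive z 1 F (dF z)) ->
  (forall z, 0 < z -> 0 <= dF z) -> F x @[x --> 0^'+] --> 0 ->
  forall x, 0 < x -> 0 <= F x.
Proof.
move=> FdF dF0 F0 x x0; apply: (cvgr_to_le F0); near=> z.
apply: (nondecreasing_pos FdF dF0); near: z; first exact: nbhs_right_gt.
exact: nbhs_right_le.
Unshelve. all: by end_near. Qed.

Lemma ge0_cvg_pinfty F dF :
  (forall z, 0 < z -> is_derive z 1 F (dF z)) ->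
  (forall z, 0 < z -> dF z <= 0) -> F x @[x --> +oo] --> 0 ->
  forall x, 0 < x -> 0 <= F x.
Proof.
move=> FdF dF0 F0 x x0.
suff : (- F) x <= 0 by rewrite oppr_le0.
have nF0 : (- F) x @[x --> +oo] --> 0 by rewrite -oppr0; exact: cvgN.
apply: (cvgr_to_ge nF0); near=> z.
apply: (@nondecreasing_pos (- F) (- dF)) => // y y0.
- by have := FdF y y0 => ?; exact: is_deriveN.
- by rewrite oppr_ge0 dF0.
Unshelve. all: by end_near. Qed.

(** The difference has derivative 0 and limit 0, so the sign lemma applies to it and to its
    opposite. *)
Lemma eq_cvg_right0 F G dF :
  (forall z, 0 < z -> is_derive z 1 F (dF z)) ->
  (forall z, 0 < z -> is_derive z 1 G (dF z)) ->
  F x @[x --> 0^'+] --> 0 -> G x @[x --> 0^'+] --> 0 ->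
  forall x, 0 < x -> F x = G x.
Proof.
have aux H K : (forall z, 0 < z -> is_derive z 1 H (dF z)) ->
    (forall z, 0 < z -> is_derive z 1 K (dF z)) ->
    H x @[x --> 0^'+] --> 0 -> K x @[x --> 0^'+] --> 0 ->
    forall x, 0 < x -> K x <= H x.
  move=> HdF KdF H0 K0 x x0; rewrite -subr_ge0.
  apply: (@ge0_cvg_right0 (H - K) (fun=> 0)) => // [z z0|].
    have := HdF z z0; have := KdF z z0 => ? ?.
    by apply: is_derive_eq; rewrite subrr.
  by have := cvgB H0 K0; rewrite subr0; apply.
move=> FdF GdF F0 G0 x x0; apply: le_anti; apply/andP; split.
  exact: (aux G F).
exact: (aux F G).
Qed.

Lemma eq_cvg_pinfty F G dF :
  (forall z, 0 < z -> is_derive z 1 F (dF z)) ->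
  (forall z, 0 < z -> is_derive z 1 G (dF z)) ->
  F x @[x --> +oo] --> 0 -> G x @[x --> +oo] --> 0 ->
  forall x, 0 < x -> F x = G x.
Proof.
have aux H K : (forall z, 0 < z -> is_derive z 1 H (dF z)) ->
    (forall z, 0 < z -> is_derive z 1 K (dF z)) ->
    H x @[x --> +oo] --> 0 -> K x @[x --> +oo] --> 0 ->
    forall x, 0 < x -> K x <= H x.
  move=> HdF KdF H0 K0 x x0; rewrite -subr_ge0.
  apply: (@ge0_cvg_pinfty (H - K) (fun=> 0)) => // [z z0|].
    have := HdF z z0; have := KdF z z0 => ? ?.
    by apply: is_derive_eq; rewrite subrr.
  by have := cvgB H0 K0; rewrite subr0; apply.
move=> FdF GdF F0 G0 x x0; apply: le_anti; apply/andP; split.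
  exact: (aux G F).
exact: (aux F G).
Qed.

Definition continuous_pos phi := forall x, 0 < x -> {for x, continuous phi}.

Lemma measurable_fun_pos phi :
  continuous_pos phi -> measurable_fun `]0 : R, +oo[ phi.
Proof.
move=> cphi; apply: open_continuous_measurable_fun => // x.
by rewrite inE/= in_itv/= andbT => /cphi.
Qed.

Lemma measurable_fun_lower phi x :
  continuous_pos phi -> measurable_fun `]0 : R, x] phi.
Proof.
move=> /measurable_fun_pos; apply: measurable_funS => //.
by apply: subset_itvl; rewrite bnd_simp.
Qed.

Lemma measurable_fun_upper phi x :
  0 < x -> continuous_pos phi -> measurable_fun `]x, +oo[ phi.
Proof.
move=> x0 /measurable_fun_pos; apply: measurable_funS => //.
by apply: subset_itvr; rewrite bnd_simp ltW.
Qed.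

Lemma integrable_setU_pos phi x : 0 < x ->
  mu.-integrable `]0, x] (EFin \o phi) ->
  mu.-integrable `]x, +oo[ (EFin \o phi) ->
  mu.-integrable `]0, +oo[ (EFin \o phi).
Proof.
move=> x0 /integrableP[m1 i1] /integrableP[m2 i2].
have E : `]0, +oo[%classic = `]0, x]%classic `|` `]x, +oo[%classic :> set R.
  by rewrite -itv_bndbnd_setU// bnd_simp ltW.
have mU : measurable_fun `]0 : R, +oo[ (EFin \o phi).
  by rewrite E; apply/measurable_funU.
apply/integrableP; split => //.
rewrite E ge0_integral_setU//.
- exact: lte_add_pinfty.
- by rewrite -E; exact: (measurableT_comp _ mU).
- apply/disj_setPS => y [/=]; rewrite 2!in_itv/= => /andP[_ yx].
  by rewrite andbT ltNge yx.
Qed.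

(** * Integrals from 0 and integrals to infinity as functions of their endpoint *)

Definition lower phi x : R := \int[mu]_(u in `]0, x]) phi u.
Definition upper phi x : R := \int[mu]_(u in `]x, +oo[) phi u.

Definition lower_integrable phi :=
  forall x, 0 < x -> mu.-integrable `]0, x] (EFin \o phi).
Definition upper_integrable phi :=
  forall x, 0 < x -> mu.-integrable `]x, +oo[ (EFin \o phi).

Lemma lowerDupper phi x : 0 < x ->
  lower_integrable phi -> upper_integrable phi ->
  \int[mu]_(u in `]0, +oo[) phi u = lower phi x + upper phi x.
Proof.
move=> x0 li ui; apply/eqP; rewrite addrC -subr_eq; apply/eqP.
apply: (@Rintegral_itvB _ phi (BRight 0) +oo%O x).
- exact: integrable_setU_pos (li _ x0) (ui _ x0).
- by rewrite bnd_simp ltW.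
- by rewrite bnd_simp.
Qed.

Lemma is_derive_lower phi x : 0 < x ->
  continuous_pos phi -> lower_integrable phi ->
  is_derive x 1 (lower phi) (phi x).
Proof.
move=> x0 cphi li.
(* The fundamental theorem needs [x] strictly inside the interval of integration. *)
have x1 : x < x + 1 by rewrite ltrDl.
have [|||d1 d2] := @continuous_FTC1 _ phi (BRight 0) _ _ x1.
- by apply: li; rewrite addr_gt0.
- exact: x0.
- exact: cphi.
- by apply: (DeriveDef d1); rewrite -derive1E; exact: d2.
Qed.

(** Near [x], the integral to infinity is the constant [upper phi c] minus an integral starting at
    [c]. The point [c] is positive because integrability is only assumed from positive points on. *)
Lemma is_derive_upper phi x : 0 < x ->
  continuous_pos phi -> upper_integrable phi ->
  is_derive x 1 (upper phi) (- phi x).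
Proof.
move=> x0 cphi ui; pose c := x / 2.
have c0 : 0 < c by rewrite divr_gt0.
have cx : c < x by rewrite /c; lra.
have x1 : x < x + 1 by rewrite ltrDl.
have [|||d1 d2] := @continuous_FTC1 _ phi (BRight c) _ _ x1.
- apply: integrableS (ui _ c0) => //.
  by apply: subset_itvl; rewrite bnd_simp.
- exact: cx.
- exact: cphi.
pose F y := \int[mu]_(t in `]c, y]) phi t.
have dF : is_derive x 1 F (phi x).
  by apply: (DeriveDef d1); rewrite -derive1E; exact: d2.
apply: (@near_eq_is_derive _ _ _ (cst (upper phi c) - F)).
  near=> y; apply: (@Rintegral_itvB _ phi (BRight c) +oo%O y).
  - exact: ui.
  - by rewrite bnd_simp ltW//; near: y; exact: lt_nbhsr.
  - by rewrite bnd_simp.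
by apply: is_derive_eq; rewrite sub0r.
Unshelve. all: by end_near. Qed.

Lemma cvg_lower phi : lower_integrable phi -> lower phi x @[x --> 0^'+] --> 0.
Proof.
move=> li.
(* Closing the interval at 0 adds a null set, which changes neither integrability nor the
   integral. *)
have i1 : mu.-integrable `[0, 1] (EFin \o phi).
  apply: (iffRL (@negligible_integrable _ _ _ mu _ [set 0] _ _ _ _ _)) => //.
  - apply/measurable_EFinP/measurable_fun_itv_obnd_cbndP/measurable_EFinP.
    exact: (measurable_int mu (li 1 ltr01)).
  - exact: lebesgue_measure_set1.
  apply: integrableS (li 1 ltr01) => //; first exact: measurableD.
  move=> z [] /=; rewrite !in_itv/= => /andP[z0 z1] /eqP zN0.
  by rewrite z1 andbT lt_neqAle eq_sym zN0.
apply: cvg_trans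
  (cvg_at_right_filter (parameterized_integral_cvg_left ltr01 i1)).
apply: near_eq_cvg; near=> x.
rewrite /parameterized_integral -Rintegral_itv_obnd_cbnd//.
exact: li.
Unshelve. all: by end_near. Qed.

(** With [upper_unique], the substitute for integration by parts and for change of variables: an
    integral is evaluated by exhibiting a primitive with the right limit. *)
Lemma lower_unique F phi : continuous_pos phi -> lower_integrable phi ->
  (forall x, 0 < x -> is_derive x 1 F (phi x)) -> F x @[x --> 0^'+] --> 0 ->
  forall x, 0 < x -> lower phi x = F x.
Proof.
move=> cphi li Fphi F0; apply: (eq_cvg_right0 (dF := phi)) => //.
- by move=> z z0; exact: is_derive_lower.
- exact: cvg_lower.
Qed.

(** Here [phi] may be singular at 0. On [u_n, x] its integral is F(x) - F(u_n) <= F(x), and monotone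
    convergence as u_n tends to 0 bounds the whole integral by F(x). *)
Lemma lower_integrable_ge0 F phi : continuous_pos phi ->
  (forall x, 0 < x -> 0 <= phi x) ->
  (forall x, 0 < x -> is_derive x 1 F (phi x)) ->
  (forall x, 0 < x -> 0 <= F x) -> lower_integrable phi.
Proof.
move=> cphi phi0 Fphi F0 x x0.
have mphi : measurable_fun `]0, x] (EFin \o phi).
  by apply/measurable_EFinP; exact: measurable_fun_lower.
apply/integrableP; split => //.
(* The offset 2 keeps [u n < x] already for n = 0. *)
pose u n : R := x / n.+2%:R.
have u0 n : 0 < u n by rewrite divr_gt0.
have ux n : u n < x by rewrite ltr_pdivrMr// ltr_pMr// ltr1n.
pose E n : set R := `[u n, x]%classic.
have E0x n : E n `<=` `]0, x]%classic.
  by apply: subset_itvr; rewrite bnd_simp.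
have EU : `]0, x]%classic = \bigcup_n E n.
  apply/seteqP; split => [y /=|y [n _ /E0x]//].
  rewrite in_itv/= => /andP[y0 yx].
  exists (Num.truncn (x / y)) => //; rewrite /E/= in_itv/= yx andbT.
  rewrite /u.
  rewrite ler_pdivrMr// mulrC -ler_pdivrMr//.
  apply/ltW/(lt_trans (truncnS_gt _)); rewrite ltr_nat//.
have FTC n : (\int[mu]_(z in E n) `|(phi z)%:E| <= (F x)%:E)%E.
  rewrite (_ : integral _ _ _ = \int[mu]_(z in E n) (phi z)%:E)%E; last first.
    apply: eq_integral => z; rewrite inE => /E0x/=.
    rewrite in_itv/= => /andP[z0 _].
    by rewrite ger0_norm ?phi0.
  have cF z : z \in `[u n, x] -> 0 < z.
    by rewrite in_itv/= => /andP[+ _]; exact: lt_le_trans.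
  rewrite (@continuous_FTC2 _ phi F)//.
  - by rewrite -EFinB lee_fin gerBl F0.
  - apply: continuous_in_subspaceT => z.
    by rewrite inE => /cF/cphi.
  - split => [z zux||].
    + have : 0 < z by apply: cF; exact: subset_itv_oo_cc zux.
      by move=> /Fphi[].
    + exact/cvg_at_right_filter/(is_derive_continuous (Fphi _ (u0 n))).
    + exact/cvg_at_left_filter/(is_derive_continuous (Fphi _ x0)).
  - move=> z zux; rewrite derive1E.
    have : 0 < z by apply: cF; exact: subset_itv_oo_cc zux.
    by move=> /Fphi[].
have ndE : nondecreasing_seq E.
  move=> m n mn; rewrite subsetEset; apply: subset_itvr; rewrite bnd_simp.
  by rewrite ler_pM2l// lef_pV2 ?posrE// ler_nat !ltnS.
have mE n : measurable_fun (E n) (fun z => `|(phi z)%:E|%E).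
  apply: measurableT_comp => //; exact: measurable_funS mphi.
have := ge0_nondecreasing_set_cvg_integral (mu := mu) ndE
  (fun=> measurable_itv _) mE (fun n z _ => abse_ge0 _).
rewrite -EU => cvgI; apply: le_lt_trans (ltry (F x)).
rewrite -(cvg_lim _ cvgI)//; apply: lime_le.
  by apply/cvg_ex; eexists; exact: cvgI.
exact: nearW.
Qed.

End CalculusOnPositiveReals.

(** * Boundedness criteria, integrals over pieces, and rapid decay at infinity *)

Section DecayAndBounds.
Context {R : realType}.
Implicit Types (f g F G dF phi psi : R -> R) (x y z u C : R).
Local Notation mu := (@lebesgue_measure R).

Lemma continuous_pos_bounded phi x y : continuous_pos phi -> 0 < x ->
  exists C, forall u, x <= u -> u <= y -> `|phi u| <= C.
Proof.
move=> cphi x0; have [xy|yx] := leP x y; last first.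
  by exists 0 => u xu uy; move: (le_trans xu uy); rewrite leNgt yx.
have [|c _ Hc] := @EVT_max _ (fun u => `|phi u|) x y xy.
  apply: continuous_in_subspaceT => z; rewrite inE/= in_itv/= => /andP[xz _].
  apply: continuous_comp; last exact: norm_continuous.
  by apply: cphi; exact: lt_le_trans xz.
by exists `|phi c| => u xu uy; apply: Hc; rewrite in_itv/= xu.
Qed.

Lemma bounded_posP F :
  bounded_pos F <-> exists C, forall x, 0 < x -> `|F x| <= C.
Proof.
split=> [/pinfty_ex_gt0[C _ FC]|[C FC]].
  by exists C => x x0; apply: FC; rewrite /= in_itv/= x0.
exists C; split; first exact: num_real.
by move=> M CM x /=; rewrite in_itv/= andbT => /FC/le_trans; apply; exact: ltW.
Qed.

(** Between the two ends, continuity on a compact interval gives the bound. *)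
Lemma bounded_pos_ends F : continuous_pos F ->
  (exists e C, 0 < e /\ forall x, 0 < x -> x <= e -> `|F x| <= C) ->
  (exists N C, forall x, 0 < x -> N <= x -> `|F x| <= C) ->
  bounded_pos F.
Proof.
move=> cF [e [C [e0 FC]]] [N [D FD]]; apply/bounded_posP.
have [E FE] := continuous_pos_bounded N cF e0.
exists (Num.max C (Num.max D E)) => x x0; rewrite !le_max.
have [xe|ex] := leP x e; first by rewrite FC.
have [Nx|xN] := leP N x; first by rewrite FD// orbT.
by rewrite FE ?orbT// ltW.
Qed.

Lemma lower_integrable_bounded phi : continuous_pos phi ->
  (forall x, 0 < x -> exists C, forall u, 0 < u -> u <= x -> `|phi u| <= C) ->
  lower_integrable phi.
Proof.
move=> cphi bphi x x0; apply: measurable_bounded_integrable => //.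
- have := @lebesgue_measure_itv R `]0, x].
  by rewrite /= lte_fin x0 -EFinB => ->; exact: ltry.
- exact: measurable_fun_lower.
- have [C HC] := bphi x x0; exists C; split; first exact: num_real.
  move=> M CM u /=; rewrite in_itv/= => /andP[u0 ux].
  by apply: le_trans (ltW CM); exact: HC.
Qed.

Lemma lower_integrableM phi psi : continuous_pos phi -> continuous_pos psi ->
  (forall x, 0 < x -> exists C, forall u, 0 < u -> u <= x -> `|psi u| <= C) ->
  lower_integrable phi -> lower_integrable (fun u => psi u * phi u).
Proof.
move=> cphi cpsi bpsi li x x0; have [C HC] := bpsi x x0.
have iC : mu.-integrable `]0, x] (fun u => C%:E * (EFin \o phi) u)%E.
  by apply: integrableZl => //; exact: li.
apply: le_integrable iC => //.
- apply/measurable_EFinP; apply: measurable_fun_lower => u u0.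
  by apply: continuousM; [exact: cpsi|exact: cphi].
- move=> u /=; rewrite in_itv/= => /andP[u0 ux].
  rewrite lee_fin !normrM ler_wpM2r//; apply: le_trans (ler_norm _).
  exact: HC.
Qed.

(** Made for the kernels: once the indicators are resolved at a fixed [x], the integrand is a
    constant times one function up to [x], and a constant times another beyond it. *)
Lemma integral_piecewise alpha beta psi (c d x : R) : 0 < x ->
  mu.-integrable `]0, x] (EFin \o alpha) ->
  mu.-integrable `]x, +oo[ (EFin \o beta) ->
  (forall u, 0 < u -> u <= x -> psi u = c * alpha u) ->
  (forall u, x < u -> psi u = d * beta u) ->
  mu.-integrable `]0, +oo[ (EFin \o psi) /\
  \int[mu]_(u in `]0, +oo[) psi u = c * lower alpha x + d * upper beta x.
Proof.
move=> x0 ia ib pa pb.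
have i1 : mu.-integrable `]0, x] (EFin \o psi).
  have : mu.-integrable `]0, x] (fun u => c%:E * (EFin \o alpha) u)%E.
    exact: integrableZl.
  apply: eq_integrable => // u.
  by rewrite inE/= in_itv/= => /andP[u0 ux]; rewrite pa.
have i2 : mu.-integrable `]x, +oo[ (EFin \o psi).
  have : mu.-integrable `]x, +oo[ (fun u => d%:E * (EFin \o beta) u)%E.
    exact: integrableZl.
  apply: eq_integrable => // u.
  by rewrite inE/= in_itv/= andbT => ux; rewrite pb.
have i := integrable_setU_pos x0 i1 i2; split => //.
apply/eqP; rewrite addrC -subr_eq; apply/eqP.
rewrite /lower /upper -!RintegralZl//.
transitivity (\int[mu]_(u in `]x, +oo[) psi u); last first.
  by apply: eq_Rintegral => u; rewrite inE/= in_itv/= andbT => ux; rewrite pb.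
rewrite -(@Rintegral_itvB _ psi (BRight 0) +oo%O x)//; last first.
  by rewrite bnd_simp ltW.
congr (_ - _).
apply: eq_Rintegral => u; rewrite inE/= in_itv/= => /andP[u0 ux].
by rewrite pa.
Qed.

(** By the mean value theorem [f] is Lipschitz on the positive half-line. *)
Lemma bounded_derivative_AC f g :
  (forall x, 0 < x -> is_derive x 1 f (g x)) -> bounded_pos g ->
  loc_abs_continuous_pos f.
Proof.
move=> fg /bounded_posP[C gC] c d c0 cd e e0.
have C0 : 0 <= C by apply: le_trans (gC c c0).
(* [C] may be 0, so [C + 1] serves as the Lipschitz constant to divide by. *)
have C1 : 0 < C + 1 by rewrite ltr_wpDl.
exists (e / (C + 1)) => [|n u v uv _ duv]; first by rewrite divr_gt0.
apply: (@le_lt_trans _ _ (\sum_(i < n) (C + 1) * (v i - u i))).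
  apply: ler_sum => i _; have [cu uvi vd] := uv i.
  have u0 : 0 < u i by exact: lt_le_trans cu.
  have [z /andP[uz zv] ->] := MVT_pos u0 uvi fg.
  rewrite normrM [`|v i - u i|]ger0_norm ?subr_ge0//.
  rewrite ler_wpM2r ?subr_ge0//; apply: le_trans (gC z _) _.
    exact: lt_le_trans uz.
  by rewrite lerDl.
by rewrite -mulr_sumr mulrC -ltr_pdivlMr.
Qed.

(** Only the behaviour at infinity is meant; starting at 1 makes the powers of [x] at least 1 and
    increasing in the exponent. *)
Definition fast_decay phi :=
  forall n, exists C, forall x, 1 <= x -> `|phi x| * x ^+ n <= C.

Definition poly_growth phi :=
  exists C n, forall x, 1 <= x -> `|phi x| <= C * x ^+ n.

Lemma fast_decayD phi psi : fast_decay phi -> fast_decay psi ->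
  fast_decay (fun x => phi x + psi x).
Proof.
move=> fphi fpsi n; have [C HC] := fphi n; have [D HD] := fpsi n.
exists (C + D) => x x1.
have x0 : 0 <= x ^+ n by rewrite exprn_ge0// (le_trans _ x1).
apply: le_trans (lerD (HC x x1) (HD x x1)).
by rewrite -mulrDl ler_wpM2r// ler_normD.
Qed.

Lemma fast_decayM phi psi : poly_growth psi -> fast_decay phi ->
  fast_decay (fun x => psi x * phi x).
Proof.
move=> [C [m HC]] fphi n; have [D HD] := fphi (m + n)%N.
exists (C * D) => x x1.
have x0 : 0 <= x by rewrite (le_trans _ x1).
have C0 : 0 <= C.
  by have := le_trans (normr_ge0 _) (HC 1 (lexx _)); rewrite expr1n mulr1.
apply: (@le_trans _ _ (C * (`|phi x| * x ^+ (m + n)))); last first.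
  by rewrite ler_wpM2l// HD.
rewrite normrM exprD; have := HC x x1.
move=> /(ler_wpM2r (mulr_ge0 (normr_ge0 (phi x)) (exprn_ge0 n x0))).
rewrite !mulrA => /le_trans; apply.
by rewrite le_eqVlt; apply/orP; left; apply/eqP; ring.
Qed.

Lemma poly_growth_linear (c d : R) : poly_growth (fun x => c * x + d).
Proof.
exists (`|c| + `|d|), 1%N => x x1; rewrite expr1 mulrDl.
apply: le_trans (ler_normD _ _) _.
rewrite normrM (ger0_norm (le_trans ler01 x1)).
by rewrite lerD2l ler_peMr.
Qed.

Lemma fast_decay_cvg phi : fast_decay phi -> phi x @[x --> +oo] --> 0.
Proof.
move=> /(_ 1%N)[C HC]; apply/cvgr0Pnorm_le => e e0; near=> x.
have x1 : 1 <= x by near: x; exact: nbhs_pinfty_ge.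
have x0 : 0 < x by rewrite (lt_le_trans _ x1).
rewrite -(ler_pM2r x0); apply: le_trans (HC x x1) _.
by rewrite mulrC -ler_pdivrMr//; near: x; exact: nbhs_pinfty_ge.
Unshelve. all: by end_near. Qed.

Lemma integral_invr_sqr x : 0 < x ->
  (\int[mu]_(u in `]x, +oo[) ((u ^+ 2)^-1)%:E = (x^-1)%:E)%E.
Proof.
move=> x0.
have c2 : continuous_pos (fun u : R => (u ^+ 2)^-1).
  move=> u u0; apply: continuousV; last exact: exprn_continuous.
  by rewrite expf_neq0 ?gt_eqF.
rewrite integral_itv_obnd_cbnd; last first.
  by apply/measurable_EFinP; exact: measurable_fun_upper.
have dF u : 0 < u -> is_derive u 1 (fun u : R => - u^-1) ((u ^+ 2)^-1).
  move=> u0; have u1 := lt0r_neq0 u0.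
  have ? := is_deriveV u1 (is_derive_id u (1 : R)).
  by apply: is_derive_eq; rewrite scaleNr opprK /GRing.scale/= mulr1.
have xpos u : u \in `]x, +oo[ -> 0 < u.
  by rewrite in_itv/= andbT; exact: lt_trans.
rewrite (@ge0_continuous_FTC2y _ _ (fun u => - u^-1) _ 0).
- by rewrite -EFinB sub0r opprK.
- by move=> u xu; rewrite invr_ge0 sqr_ge0.
- apply: continuous_in_subspaceT => u; rewrite inE/= in_itv/= andbT => xu.
  by apply: c2; exact: lt_le_trans xu.
- rewrite -oppr0; apply: cvgN; apply: (iffRL (gtr0_cvgV0 _)).
    exact: nbhs_pinfty_gt.
  exact: cvg_id.
- by move=> u xu; have [] := dF u (lt_trans x0 xu).
- exact/cvg_at_right_filter/(is_derive_continuous (dF _ x0)).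
- by move=> u /xpos/dF[_ <-]; rewrite derive1E.
Qed.

(** Comparison with u^-2, whose integral beyond x is 1/x, gives integrability and size at once. *)
Lemma le_upper_invr_sqr phi x C : 0 < x -> continuous_pos phi ->
  (forall u, x <= u -> `|phi u| <= C * (u ^+ 2)^-1) ->
  mu.-integrable `]x, +oo[ (EFin \o phi) /\ `|upper phi x| <= C / x.
Proof.
move=> x0 cphi HC.
have C0 : 0 <= C.
  have := le_trans (normr_ge0 _) (HC x (lexx _)).
  by rewrite pmulr_lge0// invr_gt0 exprn_gt0.
have isq : mu.-integrable `]x, +oo[ (fun u => ((u ^+ 2)^-1)%:E).
  apply/integrableP; split.
    apply/measurable_EFinP; apply: measurable_fun_upper => // u u0.
    apply: continuousV; last exact: exprn_continuous.
    by rewrite expf_neq0 ?gt_eqF.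
  rewrite (_ : integral _ _ _ = \int[mu]_(u in `]x, +oo[) ((u ^+ 2)^-1)%:E)%E.
    by rewrite integral_invr_sqr// ltry.
  by apply: eq_integral => u _; rewrite gee0_abs// lee_fin invr_ge0 sqr_ge0.
have iC : mu.-integrable `]x, +oo[ (fun u => C%:E * ((u ^+ 2)^-1)%:E)%E.
  exact: integrableZl.
have iphi : mu.-integrable `]x, +oo[ (EFin \o phi).
  apply: le_integrable iC => //.
    by apply/measurable_EFinP; exact: measurable_fun_upper.
  move=> u /=; rewrite in_itv/= andbT lee_fin => xu.
  by apply: le_trans (ler_norm _); exact/HC/ltW.
split => //; apply: le_trans (le_normr_Rintegral _ iphi) _ => //.
have -> : C / x = \int[mu]_(u in `]x, +oo[) (C * (u ^+ 2)^-1).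
  by rewrite RintegralZl// /Rintegral integral_invr_sqr.
apply: le_Rintegral => //; first exact: integrable_norm.
by move=> u /=; rewrite in_itv/= andbT => xu; rewrite HC// ltW.
Qed.

Lemma fast_decay_upper_integrable phi :
  continuous_pos phi -> fast_decay phi -> upper_integrable phi.
Proof.
move=> cphi fphi x x0; have [C HC] := fphi 2%N.
(* The decay bound holds only from 1 on. On [x, 1], when nonempty, continuity bounds [phi], and u^2
   <= 1 turns this into a bound by a multiple of u^-2. *)
have [D HD] := continuous_pos_bounded 1 cphi x0.
apply: (@le_upper_invr_sqr _ _ (Num.max C D) _ _ _).1 => // u xu.
have u0 : 0 < u by exact: lt_le_trans xu.
rewrite ler_pdivlMr ?exprn_gt0// le_max; have [u1|u1] := leP 1 u.
  by rewrite HC.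
apply/orP; right; apply: le_trans (HD u xu (ltW u1)).
by rewrite ler_piMr// exprn_ile1// ltW.
Qed.

(** Spending two extra powers, |phi(u)| <= (C / x^n) u^-2 for u >= x, so the tail is at most C /
    (x^n x), hence at most C / x^n for x >= 1. *)
Lemma fast_decay_upper phi :
  continuous_pos phi -> fast_decay phi -> fast_decay (upper phi).
Proof.
move=> cphi fphi n; have [C HC] := fphi n.+2.
exists C => x x1; have x0 : 0 < x by exact: lt_le_trans x1.
have xn0 : 0 < x ^+ n by rewrite exprn_gt0.
rewrite -ler_pdivlMr//.
have [|_] := @le_upper_invr_sqr phi x (C / x ^+ n) x0 cphi.
  move=> u xu; have u0 : 0 < u by exact: lt_le_trans xu.
  rewrite ler_pdivlMr ?exprn_gt0// ler_pdivlMr//.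
  apply: le_trans (HC u (le_trans x1 xu)); rewrite -mulrA ler_wpM2l//.
  have -> : u ^+ n.+2 = u ^+ n * u ^+ 2 by rewrite -exprD addn2.
  rewrite mulrC ler_wpM2r ?sqr_ge0//.
  by rewrite lerXn2r// nnegrE ltW.
move=> /le_trans; apply; rewrite ler_piMr ?invf_le1//.
have := HC 1 (lexx _); rewrite expr1n mulr1 => /(le_trans (normr_ge0 _)) C0.
by rewrite divr_ge0// ltW.
Qed.

Lemma upper_unique F phi : continuous_pos phi -> fast_decay phi ->
  (forall x, 0 < x -> is_derive x 1 F (- phi x)) -> F x @[x --> +oo] --> 0 ->
  forall x, 0 < x -> upper phi x = F x.
Proof.
move=> cphi fphi Fphi F0.
have ui := fast_decay_upper_integrable cphi fphi.
apply: (eq_cvg_pinfty (dF := fun x => - phi x)) => //.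
- by move=> z z0; exact: is_derive_upper.
- exact/fast_decay_cvg/fast_decay_upper.
Qed.

End DecayAndBounds.

(** * The Gamma density: integrability, normalization and behaviour at both ends *)

Section GammaDensity.
Context {R : realType}.
Implicit Types (a b c x y z u C : R) (phi psi : R -> R).
Local Notation mu := (@lebesgue_measure R).

Lemma eq_continuous_pos phi psi : (forall x, 0 < x -> phi x = psi x) ->
  continuous_pos phi -> continuous_pos psi.
Proof.
move=> E cphi x x0; suff : psi y @[y --> x] --> phi x by rewrite E.
apply: cvg_trans (cphi x x0); apply: near_eq_cvg; near=> y.
by apply: E; near: y; exact: lt_nbhsr.
Unshelve. all: by end_near. Qed.

Lemma eq_lower_integrable phi psi : (forall x, 0 < x -> phi x = psi x) ->
  lower_integrable phi -> lower_integrable psi.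
Proof.
move=> E li x x0; apply: eq_integrable (li x x0) => // u.
by rewrite inE/= in_itv/= => /andP[u0 _]; rewrite E.
Qed.

Lemma eq_fast_decay phi psi : (forall x, 0 < x -> phi x = psi x) ->
  fast_decay phi -> fast_decay psi.
Proof.
move=> E fphi n; have [C HC] := fphi n; exists C => x x1.
by rewrite -E ?HC// (lt_le_trans _ x1).
Qed.

(** The density without its normalizing constant. It is studied first because the positivity of that
    constant is itself deduced from integrals of the weight. *)
Definition gamma_weight a b x : R := expR (- (x / b)) * x `^ (a - 1).

Lemma gamma_weight_gt0 a b x : 0 < x -> 0 < gamma_weight a b x.
Proof. by move=> x0; rewrite mulr_gt0 ?expR_gt0 ?powR_gt0. Qed.

Lemma is_derive_gamma_weight a b x : 0 < x -> is_derive x 1 (gamma_weight a b)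
  (((a - 1) / x - b^-1) * gamma_weight a b x).
Proof.
move=> x0.
have d1 : is_derive x 1 (fun u : R => - (u / b)) (- b^-1).
  rewrite (_ : (fun _ => _) = - (b^-1 *: (@id R))); last first.
    by apply/funext => u /=; rewrite mulrC.
  by apply: is_derive_eq; rewrite /GRing.scale/= mulr1.
have d2 : is_derive x 1 (fun u : R => expR (- (u / b)))
    (expR (- (x / b)) * - b^-1).
  exact: is_derive1_comp.
have d3 := is_derive1_powR (a - 1) x0.
have d4 := is_deriveM d2 d3.
apply: is_derive_eq d4 _; rewrite /GRing.scale/= /gamma_weight.
have -> : x `^ (a - 1 - 1) = x `^ (a - 1) / x.
  by rewrite [LHS]powRB ?powRr1// ?ltW// lt0r_neq0// implybT.
ring.
Qed.

Lemma continuous_gamma_weight a b : continuous_pos (gamma_weight a b).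
Proof.
move=> x x0; exact: is_derive_continuous (is_derive_gamma_weight _ _ x0).
Qed.

(** The exponential is at most 1, and the power, singular at 0 when a < 1, has the nonnegative
    primitive x^a / a. *)
Lemma gamma_weight_lower_integrable a b : 0 < a -> 0 < b ->
  lower_integrable (gamma_weight a b).
Proof.
move=> a0 b0; have dpow c x : 0 < x ->
    is_derive x 1 (@powR R ^~ c) (c * x `^ (c - 1)).
  by move=> x0; exact: is_derive1_powR.
apply: (@lower_integrableM _ (@powR R ^~ (a - 1))
  (fun u => expR (- (u / b)))).
- by move=> x x0; exact: is_derive_continuous (dpow (a - 1) x x0).
- move=> x x0; apply: continuous_comp; last exact: continuous_expR.
  by apply: continuousN; apply: continuousM; [exact: cvg_id|exact: cvg_cst].
- move=> x x0; exists 1 => u u0 ux.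
  by rewrite ger0_norm ?expR_ge0// expR_le1 oppr_le0 divr_ge0// ltW.
- apply: (@lower_integrable_ge0 _ (fun u => a^-1 * u `^ a)).
  + by move=> x x0; exact: is_derive_continuous (dpow (a - 1) x x0).
  + by move=> x x0; exact: powR_ge0.
  + move=> x x0; have := dpow a x x0 => ?.
    rewrite (_ : (fun _ => _) = a^-1 *: (@powR R ^~ a))//.
    by apply: is_derive_eq; rewrite /GRing.scale/= mulKf// gt_eqF.
  + by move=> x x0; rewrite mulr_ge0 ?powR_ge0// invr_ge0 ltW.
Qed.

Lemma fast_decay_gamma_weight a b : 0 < b -> fast_decay (gamma_weight a b).
Proof.
(* As m > a, x^(a - 1) <= x^m for x >= 1; the exponential exp(x / b) dominates its Taylor term of
   degree N + 1, whence the constant (N + 1)! b^(N + 1). *)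
move=> b0 n; pose m := (Num.truncn a).+1; pose N := (m + n)%N.
exists (N.+1`!%:R * b ^+ N.+1) => x x1.
have x0 : 0 < x by exact: lt_le_trans x1.
rewrite (gtr0_norm (gamma_weight_gt0 _ _ x0)).
have xm : x `^ (a - 1) <= x ^+ m.
  rewrite -(powR_mulrn _ (ltW x0)); apply: ler_powR => //.
  apply: le_trans (ltW (truncnS_gt a)).
  by rewrite gerBl.
apply: (@le_trans _ _ (expR (- (x / b)) * x ^+ N.+1)).
  rewrite -mulrA ler_wpM2l ?expR_ge0//.
  apply: (@le_trans _ _ (x ^+ m * x ^+ n)).
    by rewrite ler_wpM2r// exprn_ge0// ltW.
  by rewrite -exprD ler_weXn2l.
rewrite expRN mulrC ler_pdivrMr ?expR_gt0//.
have := @expR_ge1Dxn _ (x / b) N (ltW (divr_gt0 x0 b0)).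
have f0 : 0 < N.+1`!%:R :> R by rewrite ltr0n fact_gt0.
have bN : 0 < b ^+ N.+1 by rewrite exprn_gt0.
move=> e1; have {e1} : (x / b) ^+ N.+1 / N.+1`!%:R <= expR (x / b).
  by apply: le_trans e1; rewrite lerDr.
rewrite ler_pdivrMr// expr_div_n ler_pdivrMr//.
by move=> /le_trans; apply; rewrite le_eqVlt; apply/orP; left; apply/eqP; ring.
Qed.

Lemma gamma_weight_upper_integrable a b : 0 < b ->
  upper_integrable (gamma_weight a b).
Proof.
move=> b0; apply: fast_decay_upper_integrable.
  exact: continuous_gamma_weight.
exact: fast_decay_gamma_weight.
Qed.

Lemma gamma_weight_scale a b x : 0 < b -> 0 < x ->
  b `^ a * (gamma_weight a 1 (x / b) / b) = gamma_weight a b x.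
Proof.
move=> b0 x0; rewrite /gamma_weight divr1 powRM ?invr_ge0 ?ltW//.
rewrite -(powR_inv1 (ltW b0)) -powRrM.
have -> : b `^ (-1 * (a - 1)) = b / b `^ a.
  rewrite mulN1r opprB powRB ?powRr1 ?ltW//.
  by rewrite lt0r_neq0// implybT.
rewrite powR_inv1 ?ltW//; field.
by rewrite !lt0r_neq0// powR_gt0.
Qed.

Lemma is_derive_scale phi dphi b x : is_derive (x / b) 1 phi dphi ->
  is_derive x 1 (fun u => phi (u / b)) (dphi / b).
Proof.
move=> dp; have d1 : is_derive x 1 (fun u : R => u / b) b^-1.
  rewrite (_ : (fun _ => _) = b^-1 *: (@id R)); last first.
    by apply/funext => u /=; rewrite mulrC.
  by apply: is_derive_eq; rewrite /GRing.scale/= mulr1.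
exact: (@is_derive1_comp _ phi (fun u => u / b)).
Qed.

(** The substitution of x / b for x. The left integral is split at b and the one defining the Gamma
    function at 1; each pair of pieces is matched by uniqueness of primitives, with
    [gamma_weight_scale] giving equal derivatives. *)
Lemma integral_gamma_weight a b : 0 < a -> 0 < b ->
  \int[mu]_(u in `]0, +oo[) gamma_weight a b u = b `^ a * Gamma_fun a.
Proof.
move=> a0 b0; have -> : Gamma_fun a =
    \int[mu]_(u in `]0, +oo[) gamma_weight a 1 u.
  by apply: eq_Rintegral => u _; rewrite /gamma_weight divr1 mulrC.
have cw := continuous_gamma_weight.
have b1 : 0 < b^-1 by rewrite invr_gt0.
rewrite (lowerDupper b0); last 2 first.
- exact: gamma_weight_lower_integrable.
- exact: gamma_weight_upper_integrable.
rewrite (@lowerDupper _ _ 1); last 3 first.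
- by [].
- exact: gamma_weight_lower_integrable.
- exact: gamma_weight_upper_integrable.
rewrite mulrDr; congr (_ + _).
- pose F := b `^ a *: (fun x => lower (gamma_weight a 1) (x / b)).
  transitivity (F b); last first.
    have -> : F b = b `^ a * lower (gamma_weight a 1) (b / b) by [].
    by rewrite divff// lt0r_neq0.
  apply: lower_unique => //.
  + exact: gamma_weight_lower_integrable.
  + move=> x x0; rewrite -gamma_weight_scale//.
    apply: is_deriveZ; apply: is_derive_scale; apply: is_derive_lower => //.
      by rewrite divr_gt0.
    exact: gamma_weight_lower_integrable.
  + have h : lower (gamma_weight a 1) (x / b) @[x --> 0^'+] --> 0.
      apply: (@increasing_cvg_at_right_comp _ (fun x : R => x / b)
        (lower (gamma_weight a 1)) 0 (BLeft 1)).
      * by rewrite bnd_simp.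
      * by move=> x y _ _ xy; rewrite ltr_pM2r.
      * apply: cvg_at_right_filter.
        by apply: cvgM; [exact: cvg_id|exact: cvg_cst].
      * rewrite mul0r; apply: cvg_lower.
        exact: gamma_weight_lower_integrable.
    by have := cvgM (cvg_cst (b `^ a)) h; rewrite mulr0; apply.
- pose F := b `^ a *: (fun x => upper (gamma_weight a 1) (x / b)).
  transitivity (F b); last first.
    have -> : F b = b `^ a * upper (gamma_weight a 1) (b / b) by [].
    by rewrite divff// lt0r_neq0.
  apply: upper_unique => //.
  + exact: fast_decay_gamma_weight.
  + move=> x x0; rewrite -gamma_weight_scale// -mulrN -mulNr.
    apply: is_deriveZ; apply: is_derive_scale; apply: is_derive_upper => //.
      by rewrite divr_gt0.
    exact: gamma_weight_upper_integrable.
  + have h : upper (gamma_weight a 1) (x / b) @[x --> +oo] --> 0.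
      apply: (@cvg_comp _ _ _ (fun x : R => x / b) _ _ +oo%R).
        by apply: gt0_cvgMly => //; exact: cvg_id.
      apply: fast_decay_cvg; apply: fast_decay_upper => //.
      exact: fast_decay_gamma_weight.
    by have := cvgM (cvg_cst (b `^ a)) h; rewrite mulr0; apply.
Qed.

(** Strictness comes from [1/2, 1], where the mean value theorem shows that the integral from 0
    increases by a positive amount. *)
Lemma Gamma_fun_gt0 a : 0 < a -> 0 < Gamma_fun a.
Proof.
move=> a0; have := integral_gamma_weight a0 ltr01; rewrite powR1 mul1r => <-.
have li := gamma_weight_lower_integrable a0 ltr01.
have ui := @gamma_weight_upper_integrable a 1 ltr01.
rewrite (lowerDupper ltr01 li ui); apply: ltr_pwDl; last first.
  apply: Rintegral_ge0 => u /=; rewrite in_itv/= andbT => u1.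
  by rewrite ltW// gamma_weight_gt0// (lt_trans ltr01).
have h0 : 0 < 2^-1 :> R by rewrite invr_gt0.
have h1 : 2^-1 <= 1 :> R by rewrite invf_le1// ler1n.
have [z z0|c /andP[c0 _] E] :=
  MVT_pos (f := lower (gamma_weight a 1)) (df := gamma_weight a 1) h0 h1.
  by apply: is_derive_lower => //; exact: continuous_gamma_weight.
move/eqP : E; rewrite subr_eq => /eqP ->; apply: ltr_pwDl.
  rewrite mulr_gt0 ?gamma_weight_gt0 ?(lt_le_trans _ c0)// subr_gt0.
  by rewrite invf_lt1// ltr1n.
apply: Rintegral_ge0 => u /=; rewrite in_itv/= => /andP[u0 _].
by rewrite ltW// gamma_weight_gt0.
Qed.

Section density.
Variables (a b : R) (a0 : 0 < a) (b0 : 0 < b).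
Let c := (Gamma_fun a * b `^ a)^-1.

Let c0 : 0 < c.
Proof. by rewrite invr_gt0 mulr_gt0 ?Gamma_fun_gt0 ?powR_gt0. Qed.

Let pdfE x : 0 < x -> c * gamma_weight a b x = gamma_pdf a b x.
Proof.
move=> x0; rewrite /gamma_pdf patchE mem_set; last by rewrite /= in_itv/= x0.
by rewrite /gamma_weight -mulrA [X in _ = _ * X]mulrC.
Qed.

Lemma gamma_pdf_gt0 x : 0 < x -> 0 < gamma_pdf a b x.
Proof. by move=> x0; rewrite -pdfE// mulr_gt0// gamma_weight_gt0. Qed.

Lemma is_derive_gamma_pdf x : 0 < x ->
  is_derive x 1 (gamma_pdf a b) (((a - 1) / x - b^-1) * gamma_pdf a b x).
Proof.
move=> x0; rewrite -pdfE//; apply: (eq_is_derive_pos x0 pdfE).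
have := is_derive_gamma_weight a b x0 => ?.
rewrite mulrCA; exact: is_deriveZ.
Qed.

Lemma continuous_gamma_pdf : continuous_pos (gamma_pdf a b).
Proof.
move=> x x0; exact: is_derive_continuous (is_derive_gamma_pdf x0).
Qed.

Lemma gamma_pdf_lower_integrable : lower_integrable (gamma_pdf a b).
Proof.
apply: (eq_lower_integrable pdfE).
apply: lower_integrableM; last exact: gamma_weight_lower_integrable.
- exact: continuous_gamma_weight.
- by move=> x x0; exact: cvg_cst.
- by move=> x x0; exists `|c|.
Qed.

Lemma fast_decay_gamma_pdf : fast_decay (gamma_pdf a b).
Proof.
apply: (eq_fast_decay pdfE); apply: fast_decayM.
  by have := poly_growth_linear 0 c; under eq_fun do rewrite mul0r add0r.
exact: fast_decay_gamma_weight.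
Qed.

Lemma gamma_pdf_upper_integrable : upper_integrable (gamma_pdf a b).
Proof.
exact: fast_decay_upper_integrable continuous_gamma_pdf fast_decay_gamma_pdf.
Qed.

(** Here the exact value of the normalizing constant enters. *)
Lemma gamma_cdfD x : 0 < x -> gamma_cdf a b x + gamma_ccdf a b x = 1.
Proof.
move=> x0; have li := gamma_pdf_lower_integrable.
rewrite -[LHS](lowerDupper x0 li gamma_pdf_upper_integrable).
transitivity (\int[mu]_(u in `]0, +oo[) (c * gamma_weight a b u)).
  apply: eq_Rintegral => u; rewrite inE/= in_itv/= andbT => u0.
  by rewrite pdfE.
rewrite RintegralZl//; last first.
  apply: (integrable_setU_pos x0); first exact: gamma_weight_lower_integrable.
  exact: gamma_weight_upper_integrable.
rewrite integral_gamma_weight// mulrC mulrC [_ `^ _ * _]mulrC mulVf//.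
by rewrite lt0r_neq0// mulr_gt0 ?Gamma_fun_gt0 ?powR_gt0.
Qed.

(** The factor [x] compensates the possible singularity of the density: the product is at most a
    constant times x^a. *)
Lemma cvg_mul_gamma_pdf : x * gamma_pdf a b x @[x --> 0^'+] --> 0.
Proof.
have h : c * x `^ a @[x --> 0^'+] --> 0.
  by rewrite -[X in _ --> X](mulr0 c); apply: cvgMr; exact: powR_cvg0.
apply: (squeeze_cvgr _ (cvg_cst 0) h); near=> x.
have x0 : 0 < x by near: x; exact: nbhs_right_gt.
apply/andP; split; first by rewrite mulr_ge0// ltW// gamma_pdf_gt0.
rewrite -pdfE// mulrCA; apply: ler_wpM2l; first exact: ltW.
rewrite /gamma_weight mulrCA (mulr_powRB1 (ltW x0) a0).
by rewrite ler_piMl ?powR_ge0// expR_le1 oppr_le0 divr_ge0// ltW.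
Unshelve. all: by end_near. Qed.

End density.

End GammaDensity.

(** * Derivative rules for explicitly written functions, with products in place of scalings *)

Section DerivativeRules.
Context {R : realType}.
Implicit Types (f g : R -> R) (x df dg c : R).

Lemma is_deriveM_fun f g x df dg : is_derive x 1 f df -> is_derive x 1 g dg ->
  is_derive x 1 (fun y => f y * g y) (df * g x + f x * dg).
Proof.
move=> dF dG; refine (is_derive_eq (is_deriveM dF dG) _).
by rewrite /GRing.scale/= addrC mulrC.
Qed.

Lemma is_deriveD_fun f g x df dg : is_derive x 1 f df -> is_derive x 1 g dg ->
  is_derive x 1 (fun y => f y + g y) (df + dg).
Proof. by move=> dF dG; exact: is_deriveD. Qed.

Lemma is_deriveB_fun f g x df dg : is_derive x 1 f df -> is_derive x 1 g dg ->
  is_derive x 1 (fun y => f y - g y) (df - dg).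
Proof. by move=> dF dG; exact: is_deriveB. Qed.

Lemma is_deriveN_fun f x df : is_derive x 1 f df ->
  is_derive x 1 (fun y => - f y) (- df).
Proof. by move=> dF; exact: is_deriveN. Qed.

Lemma is_deriveMl_fun f x c df : is_derive x 1 f df ->
  is_derive x 1 (fun y => c * f y) (c * df).
Proof. by move=> dF; exact: is_deriveZ. Qed.

Lemma is_deriveMr_fun f x c df : is_derive x 1 f df ->
  is_derive x 1 (fun y => f y * c) (df * c).
Proof.
move=> dF; rewrite mulrC (_ : (fun _ => _) = (fun y => c * f y)).
  exact: is_deriveMl_fun.
by apply/funext => y; rewrite mulrC.
Qed.

Lemma is_derive_id_fun x : is_derive x 1 (fun y : R => y) 1.
Proof. exact: is_derive_id. Qed.

Lemma is_derive_linear x c : is_derive x 1 (fun y : R => c * y) c.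
Proof.
refine (is_derive_eq (is_deriveMl_fun c (is_derive_id_fun x)) _).
exact: mulr1.
Qed.

Lemma is_derive_subr x c : is_derive x 1 (fun y : R => y - c) 1.
Proof.
have d := is_deriveB_fun (is_derive_id_fun x) (is_derive_cst c x 1).
refine (is_derive_eq d _).
exact: subr0.
Qed.

Lemma is_deriveX_fun f x df n : is_derive x 1 f df ->
  is_derive x 1 (fun y => f y ^+ n) (n%:R * f x ^+ n.-1 * df).
Proof.
move=> dF; have := is_deriveX n dF; rewrite exprfctE => d.
refine (is_derive_eq d _).
by rewrite /GRing.scale/= mulr_natl.
Qed.

Lemma is_derive_div_fun f g x df dg : g x != 0 ->
  is_derive x 1 f df -> is_derive x 1 g dg ->
  is_derive x 1 (fun y => f y / g y) ((df * g x - f x * dg) / g x ^+ 2).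
Proof.
move=> g0 dF dG.
refine (is_derive_eq (is_deriveM_fun dF (is_deriveV g0 dG)) _).
by rewrite /GRing.scale/=; field.
Qed.

(** The iterated derivative is identified only on the positive half-line, so each step transfers the
    next derivative along an equality valid there. *)
Lemma derive1n_pos (F : nat -> R -> R) :
  (forall k x, 0 < x -> is_derive x 1 (F k) (F k.+1 x)) ->
  forall k x, 0 < x -> derive1n k (F 0%N) x = F k x.
Proof.
move=> dF; elim=> [//|k IH] x x0; rewrite derive1nS derive1E.
have := eq_is_derive_pos x0 (fun y y0 => esym (IH y y0)) (dF k x x0).
by case.
Qed.

End DerivativeRules.

(** * The recursion for the derivatives of P / w and Pbar / w *)

Section SteinRecursion.
Context {R : realType}.
Variables (a b : R).
Hypotheses (a0 : 0 < a) (b0 : 0 < b).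
Implicit Types (x y z A B : R) (q : R -> R) (k n : nat).

Local Notation p := (gamma_pdf a b).

(* The second component is the derivative of the first one as soon as q' = p;
   carrying both makes the recursion uniform, with p in the role of 0 * Q_(-1). *)
Fixpoint stein_rec q k x : R * R :=
  if k is k'.+1 then
    let t := stein_rec q k' x in
    ((x - (a * b + k'%:R * b)) * t.1 + b * x * t.2, k%:R * t.1)
  else (q x, p x).

Definition Qn q k x := (stein_rec q k x).1.
Definition Sn q k x := (stein_rec q k x).2.
Definition den k x : R := b * x * p x * (b * x) ^+ k.

Lemma QnS q k x :
  Qn q k.+1 x = (x - (a * b + k%:R * b)) * Qn q k x + b * x * Sn q k x.
Proof. by []. Qed.

Lemma SnS q k x : Sn q k.+1 x = k.+1%:R * Qn q k x.
Proof. by []. Qed.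

Lemma den_gt0 k x : 0 < x -> 0 < den k x.
Proof. by move=> x0; rewrite !mulr_gt0 ?exprn_gt0 ?mulr_gt0 ?gamma_pdf_gt0. Qed.

Lemma denS k x : den k.+1 x = b * x * den k x.
Proof. by rewrite /den exprS mulrCA. Qed.

(** Both claims go through one induction: differentiating the recursion for Q_{k+1} brings in S_k',
    and the second claim is what cancels all terms in S_k and leaves (k + 1) Q_k. For k = 0 it is
    the differential equation of the density. *)
Lemma is_derive_stein_rec q : (forall x, 0 < x -> is_derive x 1 q (p x)) ->
  forall k x, 0 < x ->
  is_derive x 1 (Qn q k) (Sn q k x) /\
  is_derive x 1 (Sn q k)
    ((k%:R * Qn q k x - (x - (a * b + (k%:R - 1) * b)) * Sn q k x) / (b * x)).
Proof.
move=> dq; elim=> [|k IH] x x0.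
  split; first exact: dq.
  refine (is_derive_eq (is_derive_gamma_pdf a b x0) _).
  rewrite /Sn/=; field; by rewrite !lt0r_neq0.
have [dQ dS] := IH x x0; split; last first.
  refine (is_derive_eq (is_deriveMl_fun k.+1%:R dQ) _).
  rewrite QnS SnS -natr1; field; by rewrite !lt0r_neq0.
have d1 := is_deriveM_fun (is_derive_subr x (a * b + k%:R * b)) dQ.
have d2 := is_deriveM_fun (is_derive_linear x b) dS.
refine (is_derive_eq (is_deriveD_fun d1 d2) _).
rewrite SnS -natr1; field; by rewrite !lt0r_neq0.
Qed.

Lemma is_derive_Qn q : (forall x, 0 < x -> is_derive x 1 q (p x)) ->
  forall k x, 0 < x -> is_derive x 1 (Qn q k) (Sn q k x).
Proof. by move=> dq k x x0; have [] := is_derive_stein_rec dq k x0. Qed.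

Lemma continuous_Qn q : (forall x, 0 < x -> is_derive x 1 q (p x)) ->
  forall k, continuous_pos (Qn q k).
Proof.
move=> dq k x x0; exact: is_derive_continuous (is_derive_Qn dq k x0).
Qed.

Lemma is_derive_den k x : 0 < x ->
  is_derive x 1 (den k) ((a * b + k%:R * b - x) / (b * x) * den k x).
Proof.
move=> x0; have dl := is_derive_linear x b.
have dw := is_deriveM_fun dl (is_derive_gamma_pdf a b x0).
refine (is_derive_eq (is_deriveM_fun dw (is_deriveX_fun k dl)) _).
rewrite /den; case: k => [|k].
  by rewrite expr0; field; rewrite !lt0r_neq0.
by rewrite exprS/= -natr1; field; rewrite !lt0r_neq0.
Qed.

(** By [is_derive_den] the logarithmic derivative of the denominator is (ab + kb - x) / (bx), so the
    quotient rule reproduces the recursion [QnS]. *)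
Lemma is_derive_Qn_den q k x : (forall x, 0 < x -> is_derive x 1 q (p x)) ->
  0 < x ->
  is_derive x 1 (fun y => Qn q k y / den k y) (Qn q k.+1 x / den k.+1 x).
Proof.
move=> dq x0; have d0 := lt0r_neq0 (den_gt0 k x0).
have := is_derive_div_fun d0 (is_derive_Qn dq k x0) (is_derive_den k x0).
move=> d; refine (is_derive_eq d _); rewrite denS QnS; field.
by rewrite d0 !lt0r_neq0.
Qed.

Lemma derive1n_Qn_den q k x : (forall x, 0 < x -> is_derive x 1 q (p x)) ->
  0 < x ->
  derive1n k (fun y => q y / (b * y * p y)) x = Qn q k x / den k x.
Proof.
move=> dq x0.
have <- : (fun y => Qn q 0 y / den 0 y) = (fun y => q y / (b * y * p y)).
  by apply/funext => y; rewrite /den expr0 mulr1.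
apply: (@derive1n_pos _ (fun k y => Qn q k y / den k y)) => // n y y0.
exact: is_derive_Qn_den.
Qed.

(** The recursion involves x S_k and not S_k alone; this matters for k = 0, where S_0 = p may blow
    up at 0 while x p(x) tends to 0. *)
Lemma stein_rec_cvg0 q : q x @[x --> 0^'+] --> 0 ->
  forall k, Qn q k x @[x --> 0^'+] --> 0 /\ x * Sn q k x @[x --> 0^'+] --> 0.
Proof.
have id0 : x @[x --> 0^'+] --> (0 : R).
  by apply: cvg_at_right_filter; exact: cvg_id.
move=> q0; elim=> [|k [IH1 IH2]].
  by split => //; exact: cvg_mul_gamma_pdf.
split.
  rewrite (_ : Qn q k.+1 = fun x =>
      (x - (a * b + k%:R * b)) * Qn q k x + b * (x * Sn q k x)); last first.
    by apply/funext => x; rewrite QnS mulrA.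
  have := cvgD (cvgM (cvgB id0 (cvg_cst (a * b + k%:R * b))) IH1)
    (cvgM (cvg_cst b) IH2).
  by rewrite !mulr0 addr0; apply.
rewrite (_ : (fun _ => _) = fun x => k.+1%:R * (x * Qn q k x)); last first.
  by apply/funext => x; rewrite SnS mulrCA.
have := cvgM (cvg_cst (k.+1%:R : R)) (cvgM id0 IH1).
by rewrite !mulr0; apply.
Qed.

Lemma fast_decay_stein_rec q : fast_decay q ->
  forall k, fast_decay (Qn q k) /\ fast_decay (Sn q k).
Proof.
move=> fq; elim=> [|k [IH1 IH2]].
  by split => //; exact: fast_decay_gamma_pdf.
have pg (c d : R) := poly_growth_linear c d.
split.
  apply: (@fast_decayD _ (fun x => (x - (a * b + k%:R * b)) * Qn q k x)
    (fun x => b * x * Sn q k x)); apply: fast_decayM => //.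
    have := pg 1 (- (a * b + k%:R * b)).
    by under eq_fun do rewrite mul1r.
  by have := pg b 0; under eq_fun do rewrite addr0.
apply: (@fast_decayM _ (Qn q k) (fun=> k.+1%:R)) => //.
by have := pg 0 k.+1%:R; under eq_fun do rewrite mul0r add0r.
Qed.

(** * The two sequences attached to the distribution function and to its complement *)

Local Notation P := (gamma_cdf a b).
Local Notation Pbar := (gamma_ccdf a b).

Lemma is_derive_gamma_cdf x : 0 < x -> is_derive x 1 P (p x).
Proof.
move=> x0; apply: is_derive_lower => //; first exact: continuous_gamma_pdf.
exact: gamma_pdf_lower_integrable.
Qed.

Lemma is_deriveN_gamma_ccdf x : 0 < x ->
  is_derive x 1 (fun x => - Pbar x) (p x).
Proof.
move=> x0; rewrite -(opprK (p x)); apply: is_deriveN_fun.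
apply: is_derive_upper => //; first exact: continuous_gamma_pdf.
exact: gamma_pdf_upper_integrable.
Qed.

Definition lowerQ k := Qn P k.

(* The sign makes upperQ nonnegative and upperQ 0 equal to Pbar. *)
Definition upperQ k x := (-1) ^+ k.+1 * Qn (fun y => - Pbar y) k x.

Lemma lowerQ0 : lowerQ 0 = P. Proof. by []. Qed.

Lemma upperQ0 x : upperQ 0 x = Pbar x.
Proof. by rewrite /upperQ expr1 mulN1r opprK. Qed.

Lemma lowerQSS k x : lowerQ k.+2 x =
  (x - (a * b + k.+1%:R * b)) * lowerQ k.+1 x + b * x * (k.+1%:R * lowerQ k x).
Proof. by []. Qed.

(** The alternating sign reverses the first coefficient of the recursion and keeps the second; the
    Wronskian identity rests on this asymmetry. *)
Lemma upperQSS k x : upperQ k.+2 x =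
  - (x - (a * b + k.+1%:R * b)) * upperQ k.+1 x
  + b * x * (k.+1%:R * upperQ k x).
Proof. by rewrite /upperQ QnS SnS !exprS; ring. Qed.

Lemma lowerQ1 x : lowerQ 1 x = (x - a * b) * P x + b * x * p x.
Proof. by rewrite /lowerQ QnS mul0r addr0. Qed.

Lemma upperQ1 x : upperQ 1 x = - (x - a * b) * Pbar x + b * x * p x.
Proof. by rewrite /upperQ QnS mul0r addr0 sqrrN expr1n mul1r mulrN mulNr. Qed.

Lemma is_derive_lowerQ k x : 0 < x ->
  is_derive x 1 (lowerQ k.+1) (k.+1%:R * lowerQ k x).
Proof. move=> x0; exact: (is_derive_Qn is_derive_gamma_cdf k.+1 x0). Qed.

Lemma is_derive_upperQ k x : 0 < x ->
  is_derive x 1 (upperQ k.+1) (- (k.+1%:R * upperQ k x)).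
Proof.
move=> x0; have d := is_derive_Qn is_deriveN_gamma_ccdf k.+1 x0.
refine (is_derive_eq (is_deriveMl_fun ((-1) ^+ k.+2) d) _).
by rewrite SnS /upperQ !exprS; ring.
Qed.

Lemma continuous_lowerQ k : continuous_pos (lowerQ k).
Proof. exact/continuous_Qn/is_derive_gamma_cdf. Qed.

Lemma continuous_upperQ k : continuous_pos (upperQ k).
Proof.
move=> x x0; apply: continuousM; first exact: cvg_cst.
have c := continuous_Qn is_deriveN_gamma_ccdf (k := k); exact: c.
Qed.

Lemma lowerQ_cvg0 k : lowerQ k x @[x --> 0^'+] --> 0.
Proof.
apply: (stein_rec_cvg0 _ k).1.
apply: cvg_lower; exact: gamma_pdf_lower_integrable.
Qed.

Lemma fast_decay_gamma_ccdf : fast_decay Pbar.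
Proof.
apply: fast_decay_upper; first exact: continuous_gamma_pdf.
exact: fast_decay_gamma_pdf.
Qed.

Lemma fast_decay_upperQ k : fast_decay (upperQ k).
Proof.
have pg (c : R) : poly_growth (fun=> c).
  by have := poly_growth_linear 0 c; under eq_fun do rewrite mul0r add0r.
apply: fast_decayM; first exact: pg.
apply: (fast_decay_stein_rec _ k).1.
have := fast_decayM (pg (-1)) (@fast_decay_gamma_ccdf).
by under eq_fun do rewrite mulN1r.
Qed.

Lemma gamma_cdf_ge0 x : 0 <= P x.
Proof.
apply: Rintegral_ge0 => u /=; rewrite in_itv/= => /andP[u0 _].
by rewrite ltW// gamma_pdf_gt0.
Qed.

Lemma gamma_ccdf_ge0 x : 0 < x -> 0 <= Pbar x.
Proof.
move=> x0; apply: Rintegral_ge0 => u /=; rewrite in_itv/= andbT => xu.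
by rewrite ltW// gamma_pdf_gt0// (lt_trans x0).
Qed.

Lemma gamma_cdf_le1 x : 0 < x -> P x <= 1.
Proof.
by move=> x0; rewrite -(gamma_cdfD a0 b0 x0) lerDl gamma_ccdf_ge0.
Qed.

Lemma gamma_ccdf_le1 x : 0 < x -> Pbar x <= 1.
Proof.
by move=> x0; rewrite -(gamma_cdfD a0 b0 x0) lerDr gamma_cdf_ge0.
Qed.

Lemma lowerQ_ge0 k x : 0 < x -> 0 <= lowerQ k x.
Proof.
elim: k x => [|k IH] x x0; first exact: gamma_cdf_ge0.
apply: (ge0_cvg_right0 (is_derive_lowerQ k) _ (lowerQ_cvg0 k.+1)) => // z z0.
by rewrite mulr_ge0// IH.
Qed.

Lemma upperQ_ge0 k x : 0 < x -> 0 <= upperQ k x.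
Proof.
elim: k x => [|k IH] x x0; first by rewrite upperQ0 gamma_ccdf_ge0.
apply: (ge0_cvg_pinfty (is_derive_upperQ k)) => // [z z0|].
  by rewrite oppr_le0 mulr_ge0// IH.
exact/fast_decay_cvg/fast_decay_upperQ.
Qed.

(** Integrates P <= 1 inductively: the difference vanishes at 0 and has a nonnegative derivative. *)
Lemma lowerQ_le k x : 0 < x -> lowerQ k x <= x ^+ k.
Proof.
elim: k x => [|k IH] x x0; first exact: gamma_cdf_le1.
rewrite -subr_ge0.
apply: (@ge0_cvg_right0 _ (fun x => x ^+ k.+1 - lowerQ k.+1 x)
    (fun x => k.+1%:R * x ^+ k - k.+1%:R * lowerQ k x)) => // [z z0|z z0|].
- apply: is_deriveB_fun; last exact: is_derive_lowerQ.
  refine (is_derive_eq (is_deriveX_fun k.+1 (is_derive_id_fun z)) _).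
  by rewrite mulr1.
- by rewrite -mulrBr mulr_ge0// subr_ge0 IH.
- have id0 : x ^+ k.+1 @[x --> 0^'+] --> (0 : R).
    apply: cvg_at_right_filter; rewrite -[X in _ --> X](expr0n R k.+1).
    exact: exprn_continuous.
  by have := cvgB id0 (@lowerQ_cvg0 k.+1); rewrite subr0; apply.
Qed.

(** When the recursion is inserted at index k + 1, the two terms in Q_{k+1} Qbar_{k+1} cancel, which
    leaves b x (k + 1) times the identity at index k. The base case is P + Pbar = 1. *)
Lemma wronskianQ k x : 0 < x ->
  lowerQ k.+1 x * upperQ k x + lowerQ k x * upperQ k.+1 x = k`!%:R * den k x.
Proof.
move=> x0; elim: k => [|k IH].
  rewrite fact0 mul1r upperQ0 upperQ1 lowerQ1 lowerQ0 /den expr0 mulr1.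
  rewrite -[RHS]mul1r -(gamma_cdfD a0 b0 x0); ring.
rewrite factS natrM denS.
transitivity (b * x * k.+1%:R * (k`!%:R * den k x)); last by ring.
rewrite -IH lowerQSS upperQSS; ring.
Qed.

Lemma lower_lowerQ k x : 0 < x ->
  lower (lowerQ k) x = lowerQ k.+1 x / k.+1%:R.
Proof.
move=> x0; pose F x := lowerQ k.+1 x / k.+1%:R.
apply: (@lower_unique _ F (lowerQ k)); last exact: x0.
- exact: continuous_lowerQ.
- apply: lower_integrable_bounded => [|y y0]; first exact: continuous_lowerQ.
  exists (y ^+ k) => u u0 uy; rewrite ger0_norm ?lowerQ_ge0//.
  by apply: le_trans (lowerQ_le _ u0) _; rewrite lerXn2r// nnegrE ltW.
- move=> y y0.
  refine (is_derive_eq (is_deriveMr_fun k.+1%:R^-1 (is_derive_lowerQ k y0)) _).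
  by rewrite mulrAC divff ?mul1r ?pnatr_eq0.
- have := cvgM (@lowerQ_cvg0 k.+1) (cvg_cst (k.+1%:R^-1 : R)).
  by rewrite mul0r; apply.
Qed.

Lemma upper_upperQ k x : 0 < x ->
  upper (upperQ k) x = upperQ k.+1 x / k.+1%:R.
Proof.
move=> x0; pose F x := upperQ k.+1 x / k.+1%:R.
apply: (@upper_unique _ F (upperQ k)); last exact: x0.
- exact: continuous_upperQ.
- exact: fast_decay_upperQ.
- move=> y y0.
  refine (is_derive_eq (is_deriveMr_fun k.+1%:R^-1 (is_derive_upperQ k y0)) _).
  by rewrite mulNr mulrAC divff ?mul1r ?pnatr_eq0.
- have := cvgM (fast_decay_cvg (@fast_decay_upperQ k.+1))
    (cvg_cst (k.+1%:R^-1 : R)).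
  by rewrite mul0r; apply.
Qed.

End SteinRecursion.

(** * Functions bounded near 0 and of at most linear growth *)

Section LinearGrowth.
Context {R : realType}.
Implicit Types (phi psi f df : R -> R) (x y C : R).

(** Satisfied by h when |h'| <= 1 and by h' when |h''| <= 1. It is the hypothesis under which the
    kernel means converge and the boundary terms vanish. *)
Definition linear_growth phi :=
  exists C, forall x, 0 < x -> `|phi x| <= C * (1 + x).

Lemma le1_linear_growth phi :
  (forall x, 0 < x -> `|phi x| <= 1) -> linear_growth phi.
Proof.
move=> phi1; exists 1 => x x0; rewrite mul1r; apply: le_trans (phi1 x x0) _.
by rewrite lerDl ltW.
Qed.

Lemma derivative_le1_linear_growth f df :
  (forall x, 0 < x -> is_derive x 1 f (df x)) ->
  (forall x, 0 < x -> `|df x| <= 1) -> linear_growth f.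
Proof.
(* The base point is 1, since nothing is known of [f] at 0; the rest is |f(x) - f(1)| <= |x - 1| <=
   1 + x. *)
move=> fdf df1; exists (`|f 1| + 1) => x x0.
have key y z : 0 < y -> y <= z -> `|f z - f y| <= z - y.
  move=> y0 yz; have [c /andP[yc _] ->] := MVT_pos y0 yz fdf.
  rewrite normrM (@ger0_norm _ (z - y)) ?subr_ge0//.
  by rewrite ler_piMl ?subr_ge0// df1// (lt_le_trans y0).
have {}key : `|f x - f 1| <= 1 + x.
  have [x1|x1] := leP x 1.
    rewrite distrC; apply: le_trans (key _ _ x0 x1) _.
    by lra.
  by apply: le_trans (key _ _ ltr01 (ltW x1)) _; lra.
have : `|f x| <= `|f 1| + `|f x - f 1|.
  by rewrite -{1}(subrK (f 1) (f x)) addrC ler_normD.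
move=> /le_trans; apply; rewrite mulrDl mul1r lerD//.
by rewrite mulrDr mulr1 lerDl mulr_ge0// ltW.
Qed.

Lemma linear_growth_bounded phi : linear_growth phi ->
  forall x, 0 < x -> exists C, forall u, 0 < u -> u <= x -> `|phi u| <= C.
Proof.
move=> [C HC] x x0; exists (C * (1 + x)) => u u0 ux.
have C0 : 0 <= C.
  have := le_trans (normr_ge0 _) (HC 1 ltr01).
  by rewrite pmulr_lge0// addr_gt0.
by apply: le_trans (HC u u0) _; rewrite ler_wpM2l// lerD2l.
Qed.

Lemma linear_growth_poly phi : linear_growth phi -> poly_growth phi.
Proof.
move=> [C HC]; have C0 : 0 <= C.
  have := le_trans (normr_ge0 _) (HC 1 ltr01).
  by rewrite pmulr_lge0// addr_gt0.
exists (C * 2), 1%N => x x1; have x0 : 0 < x by exact: lt_le_trans x1.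
apply: le_trans (HC x x0) _; rewrite expr1 -mulrA ler_wpM2l//.
by rewrite mulr_natl mulr2n lerD2r.
Qed.

Lemma linear_growthM_cvg0 phi psi : linear_growth phi ->
  psi x @[x --> 0^'+] --> 0 -> phi x * psi x @[x --> 0^'+] --> 0.
Proof.
move=> lphi psi0; have [C HC] := linear_growth_bounded lphi ltr01.
have h : C * `|psi x| @[x --> 0^'+] --> 0.
  by have := cvgM (cvg_cst C) (cvg_norm psi0); rewrite normr0 mulr0; apply.
apply/cvgr0Pnorm_le => e e0; move/cvgr0Pnorm_le : h => /(_ e e0) h.
near=> x; have x0 : 0 < x by near: x; exact: nbhs_right_gt.
apply: (@le_trans _ _ `|C * `|psi x| |); last by near: x; exact: h.
apply: le_trans (ler_norm _); rewrite normrM ler_wpM2r// HC//.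
by near: x; exact: nbhs_right_le.
Unshelve. all: by end_near. Qed.

End LinearGrowth.

(** * Behaviour of the sequences at both ends, and the functions [Vn] built from them *)

Section SteinFunctions.
Context {R : realType}.
Variables (a b : R).
Hypotheses (a0 : 0 < a) (b0 : 0 < b).
Implicit Types (x y z u C : R) (phi h : R -> R) (j k n : nat).

Local Notation mu := (@lebesgue_measure R).
Local Notation p := (gamma_pdf a b).
Local Notation P := (gamma_cdf a b).
Local Notation Pbar := (gamma_ccdf a b).
Local Notation loQ := (lowerQ a b).
Local Notation upQ := (upperQ a b).
Local Notation dn := (den a b).

(** Since Q_{k+1} >= 0, the recursion reads (ab + kb - x) Q_k <= b x S_k, and for x <= ab/2 the
    coefficient on the left is at least ab/2. So Q_k is controlled by x Q_{k-1}, or by x p when k =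
    0. *)
Lemma lowerQ_right0 k : exists C, 0 <= C /\
  forall x, 0 < x -> x <= a * b / 2 -> loQ k x <= C * dn k x.
Proof.
have ab0 : 0 < a * b by rewrite mulr_gt0.
elim: k => [|k [C [C0 HC]]].
  exists (2 / (a * b)); split => [|x x0 xab]; first by rewrite divr_ge0// ltW.
  rewrite mulrAC ler_pdivlMr// -ler_pdivrMl//.
  have := lowerQ_ge0 a0 b0 1 x0; rewrite lowerQ1 lowerQ0 /den expr0 mulr1.
  have := gamma_cdf_ge0 a0 b0 x; nra.
exists (k.+1%:R * C * (2 / (a * b))); split => [|x x0 xab].
  by rewrite !mulr_ge0// invr_ge0 ltW.
have Q0 := lowerQ_ge0 a0 b0 k.+1 x0.
have : loQ k.+1 x * (a * b / 2) <= k.+1%:R * C * dn k.+1 x.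
  apply: (@le_trans _ _ (b * x * (k.+1%:R * loQ k x))).
    have := lowerQ_ge0 a0 b0 k.+2 x0; rewrite lowerQSS.
    have : 0 <= k.+1%:R * b * loQ k.+1 x by rewrite !mulr_ge0// ltW.
    nra.
  rewrite (_ : k.+1%:R * C * _ = b * x * (k.+1%:R * (C * dn k x))).
    by rewrite ler_wpM2l ?mulr_ge0 ?(ltW b0) ?(ltW x0)// ler_wpM2l// HC.
  by rewrite denS; ring.
rewrite -ler_pdivlMr ?divr_gt0// invf_div.
by move=> /le_trans; apply; rewrite mulrAC.
Qed.

Lemma upperQ_right0 k x : 0 < x ->
  exists C, forall u, 0 < u -> u <= x -> upQ k u <= C.
Proof.
(* The recursion has order two, so two consecutive indices are bounded together. *)
move=> x0; suff : (exists C, forall u, 0 < u -> u <= x -> upQ k u <= C) /\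
    (exists C, forall u, 0 < u -> u <= x -> upQ k.+1 u <= C) by case.
elim: k => [|k [[C HC] [D HD]]].
  split; first by exists 1 => u u0 _; rewrite upperQ0 gamma_ccdf_le1.
  (* The first ab bounds the term in Pbar. The rest bounds b u p(u), which the inequality Q_1 <= u
     limits to u + ab. *)
  exists (a * b + (x + a * b)) => u u0 ux.
  have := lowerQ_le a0 b0 1 u0; rewrite lowerQ1 expr1 upperQ1.
  have := gamma_cdf_ge0 a0 b0 u; have := gamma_ccdf_ge0 a0 b0 u0.
  have := gamma_cdfD a0 b0 u0; have : 0 < a * b by rewrite mulr_gt0.
  nra.
split; first by exists D.
exists ((a * b + k.+1%:R * b) * D + b * x * (k.+1%:R * C)) => u u0 ux.
rewrite upperQSS.
have U1 := upperQ_ge0 a0 b0 k.+1 u0; have U0 := upperQ_ge0 a0 b0 k u0.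
apply: lerD.
  apply: (@le_trans _ _ ((a * b + k.+1%:R * b) * upQ k.+1 u)).
    by rewrite ler_wpM2r// opprB gerBl ltW.
  by rewrite ler_wpM2l ?HD// addr_ge0// mulr_ge0// ltW.
apply: ler_pM.
- by rewrite mulr_ge0// ltW.
- by rewrite mulr_ge0.
- by rewrite ler_wpM2l// ltW.
- by rewrite ler_wpM2l// HC.
Qed.

(** Mirror image of the bound near 0: nonnegativity of the next term gives (x - c) Qbar_k <= b x k
    Qbar_{k-1} with c = ab + kb, and x - c >= x / 2 once x >= 2c. For k = 0 the right-hand side is b
    x p. *)
Lemma upperQ_pinfty k : exists N C, 0 <= C /\
  forall x, 0 < x -> N <= x -> upQ k x <= C * p x.
Proof.
have key (c U V x : R) : 0 < x -> 2 * c <= x -> 0 <= U ->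
    (x - c) * U <= x * V -> U <= 2 * V.
  move=> x0 cx U0 UV; rewrite -(ler_pM2l x0); nra.
elim: k => [|k [N [C [C0 HC]]]].
  exists (2 * (a * b)), (2 * b); split => [|x x0 xN].
    by rewrite mulr_ge0// ltW.
  rewrite -mulrA; apply: (key (a * b) _ _ x) => //; first exact: upperQ_ge0.
  by have := upperQ_ge0 a0 b0 1 x0; rewrite upperQ1 upperQ0; nra.
exists (Num.max N (2 * (a * b + k.+1%:R * b))), (2 * (b * (k.+1%:R * C))).
split => [|x x0]; first by rewrite !mulr_ge0// ltW.
rewrite ge_max => /andP[Nx cx].
apply: (@le_trans _ _ (2 * (b * (k.+1%:R * upQ k x)))).
  apply: (key (a * b + k.+1%:R * b) _ _ x) => //; first exact: upperQ_ge0.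
  by have := upperQ_ge0 a0 b0 k.+2 x0; rewrite upperQSS; nra.
rewrite -!mulrA !ler_wpM2l ?(ltW b0)//.
exact: HC.
Qed.

(** For k = j + 1, half of the bound on [Vn j k], the one case that the Wronskian does not
    evaluate. *)
Definition Jn k x := loQ k x * upQ k x / dn k x.

Lemma Jn_right0 k :
  exists e C, 0 < e /\ forall x, 0 < x -> x <= e -> Jn k x <= C.
Proof.
have e0 : 0 < a * b / 2 by rewrite divr_gt0// mulr_gt0.
have [C [C0 HC]] := lowerQ_right0 k; have [D HD] := upperQ_right0 k e0.
exists (a * b / 2), (C * D); split => // x x0 xe.
rewrite /Jn ler_pdivrMr ?den_gt0// mulrAC.
by apply: ler_pM; rewrite ?lowerQ_ge0 ?upperQ_ge0 ?HC ?HD.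
Qed.

Lemma Jn_pinfty k :
  exists N C, forall x, 0 < x -> N <= x -> x * Jn k x <= C.
Proof.
have [N [C [C0 HC]]] := upperQ_pinfty k.
exists N, (C / b ^+ k.+1) => x x0 xN.
rewrite /Jn mulrA ler_pdivrMr ?den_gt0//.
(* The density in the denominator cancels the one bounding Qbar_k, and x^k bounds Q_k. *)
have -> : C / b ^+ k.+1 * dn k x = x * (x ^+ k * (C * p x)).
  rewrite /den exprMn exprS; field.
  by rewrite expf_neq0 lt0r_neq0.
rewrite ler_wpM2l ?(ltW x0)//.
by apply: ler_pM; rewrite ?lowerQ_ge0 ?upperQ_ge0 ?lowerQ_le ?HC.
Qed.

Definition An j phi x := lower (fun u => phi u * loQ j u) x.
Definition Bn j phi x := upper (fun u => phi u * upQ j u) x.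

(** One formula for both kernel families: the mean of phi K^{k,1} for j = 0 and of phi K^{k,2} for j
    = 1. The sign combines (-1)^k from the k-th derivative of [upperM] with (-1)^j, since the first
    term of the kernel changes sign between the families. *)
Definition Vn j k phi x :=
  - (((-1) ^+ (j + k) * upQ k x * An j phi x + loQ k x * Bn j phi x)
     / dn k x).

Lemma is_derive_upperQ_den k x : 0 < x ->
  is_derive x 1 (fun y => (-1) ^+ k * upQ k y / dn k y)
    ((-1) ^+ k.+1 * upQ k.+1 x / dn k.+1 x).
Proof.
move=> x0.
have := is_deriveN_fun
  (is_derive_Qn_den a0 b0 k (is_deriveN_gamma_ccdf a b0) x0).
have sgn n : (-1) ^+ n * (-1) ^+ n.+1 = -1 :> R.
  by rewrite exprS mulrCA -expr2 sqrr_sign mulr1.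
rewrite /upperQ.
have E n y : - (Qn a b (fun y => - Pbar y) n y / dn n y) =
    (-1) ^+ n * ((-1) ^+ n.+1 * Qn a b (fun y => - Pbar y) n y) / dn n y.
  by rewrite (mulrA ((-1) ^+ n)) sgn mulN1r mulNr.
by rewrite E; under eq_fun do rewrite E.
Qed.

Lemma derive1n_lowerM k x : 0 < x ->
  derive1n k (lowerM a b) x = loQ k x / dn k x.
Proof. by move=> x0; exact: derive1n_Qn_den (is_derive_gamma_cdf a0 b0) x0. Qed.

Lemma derive1n_upperM k x : 0 < x ->
  derive1n k (upperM a b) x = (-1) ^+ k * upQ k x / dn k x.
Proof.
move=> x0; have := derive1n_pos is_derive_upperQ_den k x0.
rewrite (_ : (fun _ => _) = upperM a b)//; apply/funext => y.
by rewrite expr0 mul1r upperQ0 /den expr0 mulr1.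
Qed.

Section test_function.
Variable phi : R -> R.
Hypotheses (cphi : continuous_pos phi) (lphi : linear_growth phi).

Lemma continuous_phi_lowerQ j : continuous_pos (fun u => phi u * loQ j u).
Proof.
move=> u u0; apply: continuousM; first exact: cphi.
exact: continuous_lowerQ.
Qed.

Lemma continuous_phi_upperQ j : continuous_pos (fun u => phi u * upQ j u).
Proof.
move=> u u0; apply: continuousM; first exact: cphi.
exact: continuous_upperQ.
Qed.

Lemma phi_lowerQ_integrable j : lower_integrable (fun u => phi u * loQ j u).
Proof.
apply: lower_integrable_bounded; first exact: continuous_phi_lowerQ.
move=> x x0; have [C HC] := linear_growth_bounded lphi x0.
exists (C * x ^+ j) => u u0 ux; rewrite normrM; apply: ler_pM => //.
  exact: HC.
rewrite ger0_norm ?lowerQ_ge0//; apply: le_trans (lowerQ_le _ _ _ u0) _ => //.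
by rewrite lerXn2r// nnegrE ltW.
Qed.

Lemma fast_decay_phi_upperQ j : fast_decay (fun u => phi u * upQ j u).
Proof.
apply: fast_decayM; first exact: linear_growth_poly.
exact: fast_decay_upperQ.
Qed.

Lemma phi_upperQ_integrable j : upper_integrable (fun u => phi u * upQ j u).
Proof.
apply: fast_decay_upper_integrable; first exact: continuous_phi_upperQ.
exact: fast_decay_phi_upperQ.
Qed.

Lemma is_derive_An j x : 0 < x -> is_derive x 1 (An j phi) (phi x * loQ j x).
Proof.
move=> x0; apply: (is_derive_lower x0); first exact: continuous_phi_lowerQ.
exact: phi_lowerQ_integrable.
Qed.

Lemma is_derive_Bn j x : 0 < x ->
  is_derive x 1 (Bn j phi) (- (phi x * upQ j x)).
Proof.
move=> x0; apply: (is_derive_upper x0); first exact: continuous_phi_upperQ.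
exact: phi_upperQ_integrable.
Qed.

Lemma An_cvg0 j : An j phi x @[x --> 0^'+] --> 0.
Proof. by apply: cvg_lower; exact: phi_lowerQ_integrable. Qed.

Lemma Bn_cvg0 j : Bn j phi x @[x --> +oo] --> 0.
Proof.
apply/fast_decay_cvg/fast_decay_upper; first exact: continuous_phi_upperQ.
exact: fast_decay_phi_upperQ.
Qed.

(** Differentiating the coefficients raises [k]; differentiating the integrals [An] and [Bn]
    produces the boundary term. *)
Lemma is_derive_Vn j k x : 0 < x ->
  is_derive x 1 (Vn j k phi) (Vn j k.+1 phi x +
    phi x * (loQ k x * upQ j x - (-1) ^+ (j + k) * upQ k x * loQ j x)
    / dn k x).
Proof.
move=> x0.
have d1 := is_deriveM_fun
  (is_deriveMl_fun ((-1) ^+ j) (is_derive_upperQ_den k x0)) (is_derive_An j x0).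
have d2 := is_deriveM_fun
  (is_derive_Qn_den a0 b0 k (is_derive_gamma_cdf a0 b0) x0) (is_derive_Bn j x0).
have d := is_deriveN_fun (is_deriveD_fun d1 d2).
have E n y : Vn j n phi y = - ((-1) ^+ j * ((-1) ^+ n * upQ n y / dn n y) *
    An j phi y + Qn a b P n y / dn n y * Bn j phi y).
  rewrite /Vn /lowerQ exprD; ring.
rewrite (funext (E k)).
refine (is_derive_eq d _).
rewrite E exprD /lowerQ; ring.
Qed.

(** For k = j the two boundary contributions are equal with opposite signs. *)
Lemma is_derive_Vn0 j x : 0 < x ->
  is_derive x 1 (Vn j j phi) (Vn j j.+1 phi x).
Proof.
move=> x0; refine (is_derive_eq (is_derive_Vn j j x0) _).
rewrite addnn -signr_odd odd_double expr0; ring.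
Qed.

(** For k = j + 1 the sign flips, and the contributions add up to the Wronskian of index j. *)
Lemma is_derive_Vn1 j x : 0 < x ->
  is_derive x 1 (Vn j j.+1 phi) (Vn j j.+2 phi x + j`!%:R * (phi x / (b * x))).
Proof.
move=> x0; refine (is_derive_eq (is_derive_Vn j j.+1 x0) _); congr (_ + _).
rewrite addnS addnn -signr_odd/= odd_double expr1 mulN1r mulNr opprK.
rewrite [upQ _ _ * _]mulrC (wronskianQ a0 b0 j x0) denS.
by field; rewrite !lt0r_neq0// den_gt0.
Qed.

Hypothesis phi1 : forall x, 0 < x -> `|phi x| <= 1.

(** Adding or subtracting [An] from the bound gives a function vanishing at 0 with derivative (1 +
    phi) Q_j or (1 - phi) Q_j, both nonnegative. *)
Lemma An_le j x : 0 < x -> `|An j phi x| <= loQ j.+1 x / j.+1%:R.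
Proof.
move=> x0.
have dQ y (y0 : 0 < y) :=
  is_deriveMr_fun j.+1%:R^-1 (is_derive_lowerQ a0 b0 j y0).
have Q0 : loQ j.+1 x / j.+1%:R @[x --> 0^'+] --> 0.
  have := cvgM (@lowerQ_cvg0 _ _ _ a0 b0 j.+1) (cvg_cst (j.+1%:R^-1 : R)).
  by rewrite mul0r; apply.
rewrite ler_norml; apply/andP; split; rewrite -subr_ge0 ?opprK.
- have dd y (y0 : 0 < y) := is_deriveD_fun (is_derive_An j y0) (dQ y y0).
  apply: (ge0_cvg_right0 dd) => //.
    move=> y y0; rewrite mulrAC divff ?mul1r ?pnatr_eq0//.
    rewrite -{2}[loQ j y]mul1r -mulrDl.
    rewrite mulr_ge0 ?lowerQ_ge0//.
    have := phi1 y0; rewrite ler_norml => /andP[+ _].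
    by rewrite -subr_ge0 opprK.
  by have := cvgD (@An_cvg0 j) Q0; rewrite addr0; apply.
- have dd y (y0 : 0 < y) := is_deriveB_fun (dQ y y0) (is_derive_An j y0).
  apply: (ge0_cvg_right0 dd) => //.
    move=> y y0; rewrite mulrAC divff ?mul1r ?pnatr_eq0//.
    rewrite -{1}[loQ j y]mul1r -mulrBl.
    rewrite mulr_ge0 ?lowerQ_ge0//.
    by have := phi1 y0; rewrite ler_norml => /andP[_ +]; rewrite -subr_ge0.
  by have := cvgB Q0 (@An_cvg0 j); rewrite subr0; apply.
Qed.

Lemma Bn_le j x : 0 < x -> `|Bn j phi x| <= upQ j.+1 x / j.+1%:R.
Proof.
move=> x0.
have dQ y (y0 : 0 < y) :=
  is_deriveMr_fun j.+1%:R^-1 (is_derive_upperQ a b0 j y0).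
have Q0 : upQ j.+1 x / j.+1%:R @[x --> +oo] --> 0.
  have := cvgM (fast_decay_cvg (fast_decay_upperQ a b0 j.+1))
    (cvg_cst (j.+1%:R^-1 : R)).
  by rewrite mul0r; apply.
rewrite ler_norml; apply/andP; split; rewrite -subr_ge0 ?opprK.
- have dd y (y0 : 0 < y) := is_deriveD_fun (is_derive_Bn j y0) (dQ y y0).
  apply: (ge0_cvg_pinfty dd) => //.
    move=> y y0; rewrite mulNr mulrAC divff ?mul1r ?pnatr_eq0// -opprD oppr_le0.
    rewrite -{2}[upQ j y]mul1r -mulrDl mulr_ge0 ?upperQ_ge0//.
    have := phi1 y0; rewrite ler_norml => /andP[+ _].
    by rewrite -subr_ge0 opprK.
  by have := cvgD (@Bn_cvg0 j) Q0; rewrite addr0; apply.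
- have dd y (y0 : 0 < y) := is_deriveB_fun (dQ y y0) (is_derive_Bn j y0).
  apply: (ge0_cvg_pinfty dd) => //.
    move=> y y0; rewrite mulNr mulrAC divff ?mul1r ?pnatr_eq0// -opprD oppr_le0.
    rewrite -{1}[upQ j y]mul1r -mulNr -mulrDl mulr_ge0 ?upperQ_ge0//.
    by have := phi1 y0; rewrite ler_norml => /andP[_ +]; rewrite -subr_ge0.
  by have := cvgB Q0 (@Bn_cvg0 j); rewrite subr0; apply.
Qed.

Lemma Vn_le j k x : 0 < x -> `|Vn j k phi x| <=
  (upQ k x * loQ j.+1 x + loQ k x * upQ j.+1 x) / j.+1%:R / dn k x.
Proof.
move=> x0.
have aux (s u l A B c d : R) : `|s| = 1 -> 0 <= u -> 0 <= l ->
    `|A| <= c -> `|B| <= d -> `|s * u * A + l * B| <= u * c + l * d.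
  move=> s1 u0 l0 Ac Bd; apply: le_trans (ler_normD _ _) _.
  by rewrite !normrM s1 mul1r (ger0_norm u0) (ger0_norm l0) lerD// ler_wpM2l.
have d0 := den_gt0 a0 b0 k x0.
rewrite /Vn normrN normrM normfV (gtr0_norm d0) ler_pM2r ?invr_gt0//.
apply: le_trans (aux _ _ _ _ _ _ _ _ (upperQ_ge0 a0 b0 k x0)
  (lowerQ_ge0 a0 b0 k x0) (An_le j x0) (Bn_le j x0)) _.
  by rewrite normrX normrN1 expr1n.
by rewrite !mulrA -mulrDl.
Qed.

(** The numerator in [Vn_le] is the Wronskian of index j, and the denominator cancels. *)
Lemma Vn0_le j x : 0 < x -> `|Vn j j phi x| <= j`!%:R / j.+1%:R.
Proof.
move=> x0; apply: le_trans (Vn_le j j x0) _.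
rewrite [upQ j x * _]mulrC (wronskianQ a0 b0 j x0) mulrAC mulfK//.
by rewrite lt0r_neq0// den_gt0.
Qed.

Lemma Vn1_le j x : 0 < x -> `|Vn j j.+1 phi x| <= 2 * Jn j.+1 x.
Proof.
move=> x0; apply: le_trans (Vn_le j j.+1 x0) _.
rewrite /Jn [upQ _ x * _]mulrC; set t := loQ _ x * _.
have t0 : 0 <= t by rewrite mulr_ge0// ?lowerQ_ge0 ?upperQ_ge0.
rewrite mulrA ler_pM2r ?invr_gt0 ?den_gt0// ler_pdivrMr//.
have : 1 <= j.+1%:R :> R by rewrite ler1n.
nra.
Qed.

(** The numerator is now the Wronskian of index j + 1, one power of bx short of the denominator. *)
Lemma Vn2_le j x : 0 < x -> `|Vn j j.+2 phi x| <= j`!%:R / (b * x).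
Proof.
move=> x0; apply: le_trans (Vn_le j j.+2 x0) _.
rewrite addrC [upQ j.+2 x * _]mulrC (wronskianQ a0 b0 j.+1 x0).
rewrite (denS _ _ j.+1) factS natrM le_eqVlt; apply/orP; left; apply/eqP.
have := lt0r_neq0 (den_gt0 a0 b0 j.+1 x0).
have : j.+1%:R != 0 :> R by rewrite pnatr_eq0.
move: (j.+1%:R) (dn j.+1 x) => c d c0 d0.
by field; rewrite c0 d0 !lt0r_neq0.
Qed.

End test_function.

End SteinFunctions.

(** * Kernel means, integration by parts, the Stein equation and the bounds *)

Section SteinEquation.
Context {R : realType}.
Variables (a b : R).
Hypotheses (a0 : 0 < a) (b0 : 0 < b).
Implicit Types (x y z u v C : R) (phi h F G : R -> R) (j k n : nat).

Local Notation mu := (@lebesgue_measure R).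
Local Notation p := (gamma_pdf a b).
Local Notation P := (gamma_cdf a b).
Local Notation Pbar := (gamma_ccdf a b).
Local Notation loQ := (lowerQ a b).
Local Notation upQ := (upperQ a b).
Local Notation dn := (den a b).
Local Notation A := (An a b).
Local Notation B := (Bn a b).
Local Notation V := (Vn a b).

(** The density of the mean cancels the one dividing in the kernels. *)
Let mul_divfK (f c d q : R) : q != 0 -> f * (c * (d / q)) * q = c * (f * d).
Proof. by move=> q0; field. Qed.

Lemma kernel1_mean phi k x : continuous_pos phi -> linear_growth phi -> 0 < x ->
  gamma_integrable a b (fun u => phi u * kernel1 a b k u x) /\
  gamma_mean a b (fun u => phi u * kernel1 a b k u x) = V 0 k phi x.
Proof.
move=> cphi lphi x0.
have E : V 0 k phi x = - ((-1) ^+ k * upQ k x / dn k x) * A 0 phi x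
    + - (loQ k x / dn k x) * B 0 phi x.
  by rewrite /Vn add0n mulrDl opprD !mulNr !(mulrAC _ _ (dn k x)^-1).
rewrite E; apply: integral_piecewise => //.
- exact: phi_lowerQ_integrable.
- exact: phi_upperQ_integrable.
- move=> u u0 ux; have p0 := lt0r_neq0 (gamma_pdf_gt0 a0 b0 u0).
  rewrite /kernel1 ux ltNge ux [X in X - _]mulr1 [X in _ - X]mulr0 subr0
    (derive1n_upperM a0 b0 k x0).
  rewrite lowerQ0; exact: mul_divfK.
- move=> u xu; have p0 := lt0r_neq0 (gamma_pdf_gt0 a0 b0 (lt_trans x0 xu)).
  rewrite /kernel1 xu leNgt xu [X in X - _]mulr0 [X in _ - X]mulr1 sub0r
    (derive1n_lowerM a0 b0 k x0).
  rewrite upperQ0 -mulNr; exact: mul_divfK.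
Qed.

Lemma gamma_cdf1E u : 0 < u -> gamma_cdf1 a b u = loQ 1 u.
Proof. by move=> u0; rewrite [LHS](lower_lowerQ a0 b0 0 u0) divr1. Qed.

Lemma gamma_ccdf1E u : 0 < u -> gamma_ccdf1 a b u = upQ 1 u.
Proof.
move=> u0; rewrite -[RHS]divr1; have <- := upper_upperQ a b0 0 u0.
rewrite (_ : upperQ a b 0 = Pbar)//; apply/funext => y; exact: upperQ0.
Qed.

Lemma kernel2_mean phi k x : continuous_pos phi -> linear_growth phi -> 0 < x ->
  gamma_integrable a b (fun u => phi u * kernel2 a b k u x) /\
  gamma_mean a b (fun u => phi u * kernel2 a b k u x) = V 1 k phi x.
Proof.
move=> cphi lphi x0.
have E : V 1 k phi x = ((-1) ^+ k * upQ k x / dn k x) * A 1 phi x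
    + - (loQ k x / dn k x) * B 1 phi x.
  by rewrite /Vn exprD expr1 !mulN1r; ring.
rewrite E; apply: integral_piecewise => //.
- exact: phi_lowerQ_integrable.
- exact: phi_upperQ_integrable.
- move=> u u0 ux; have p0 := lt0r_neq0 (gamma_pdf_gt0 a0 b0 u0).
  rewrite /kernel2 ux ltNge ux [X in X - _]mulr1 [X in _ - X]mulr0 subr0
    (derive1n_upperM a0 b0 k x0).
  rewrite (gamma_cdf1E u0); exact: (mul_divfK _ _ _ p0).
- move=> u xu; have u0 := lt_trans x0 xu.
  have p0 := lt0r_neq0 (gamma_pdf_gt0 a0 b0 u0).
  rewrite /kernel2 xu leNgt xu [X in X - _]mulr0 [X in _ - X]mulr1 sub0r
    (derive1n_lowerM a0 b0 k x0).
  rewrite (gamma_ccdf1E u0) -mulNr; exact: (mul_divfK _ _ _ p0).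
Qed.

Section integrals_against_density.
Variable h : R -> R.
Hypotheses (ch : continuous_pos h) (lh : linear_growth h).

Lemma continuous_mul_pdf : continuous_pos (fun u => h u * p u).
Proof.
move=> u u0; apply: continuousM; first exact: ch.
exact: continuous_gamma_pdf.
Qed.

Lemma mul_pdf_lower_integrable : lower_integrable (fun u => h u * p u).
Proof.
apply: lower_integrableM.
- exact: continuous_gamma_pdf.
- exact: ch.
- exact: linear_growth_bounded.
- exact: gamma_pdf_lower_integrable.
Qed.

Lemma fast_decay_mul_pdf : fast_decay (fun u => h u * p u).
Proof.
apply: fast_decayM; first exact: linear_growth_poly.
exact: fast_decay_gamma_pdf.
Qed.

Lemma mul_pdf_upper_integrable : upper_integrable (fun u => h u * p u).
Proof.
apply: fast_decay_upper_integrable; first exact: continuous_mul_pdf.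
exact: fast_decay_mul_pdf.
Qed.

Lemma linear_growth_gamma_integrable : gamma_integrable a b h.
Proof.
apply: (integrable_setU_pos ltr01 (phi := fun u => h u * p u)).
  exact: mul_pdf_lower_integrable.
exact: mul_pdf_upper_integrable.
Qed.

Lemma gamma_meanE x : 0 < x -> gamma_mean a b h =
  lower (fun u => h u * p u) x + upper (fun u => h u * p u) x.
Proof.
move=> x0; apply: lowerDupper => //.
  exact: mul_pdf_lower_integrable.
exact: mul_pdf_upper_integrable.
Qed.

End integrals_against_density.

(** * Integration by parts against the distribution functions and their primitives *)

Section integration_by_parts.
Variables (h dh : R -> R).
Hypotheses (hdh : forall x, 0 < x -> is_derive x 1 h (dh x))
  (cdh : continuous_pos dh) (ldh : linear_growth dh) (lh : linear_growth h).

Let ch : continuous_pos h.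
Proof. by move=> x x0; exact: is_derive_continuous (hdh x0). Qed.

(** The boundary term h P vanishes at 0 because [h] stays bounded there. *)
Lemma An0_parts x : 0 < x ->
  A 0 dh x = h x * P x - lower (fun u => h u * p u) x.
Proof.
move=> x0; have li := mul_pdf_lower_integrable ch lh.
apply: (@lower_unique _ (fun x => h x * P x - lower (fun u => h u * p u) x)
  (fun u => dh u * loQ 0 u)); last exact: x0.
- exact: continuous_phi_lowerQ.
- exact: phi_lowerQ_integrable.
- move=> y y0.
  have d1 := is_deriveM_fun (hdh y0) (is_derive_gamma_cdf a0 b0 y0).
  have d2 := is_derive_lower y0 (continuous_mul_pdf ch) li.
  refine (is_derive_eq (is_deriveB_fun d1 d2) _).
  by rewrite addrK.
- have h0 := linear_growthM_cvg0 lh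
    (cvg_lower (gamma_pdf_lower_integrable a0 b0)).
  by have := cvgB h0 (cvg_lower li); rewrite subr0; apply.
Qed.

Lemma Bn0_parts x : 0 < x ->
  B 0 dh x = upper (fun u => h u * p u) x - h x * Pbar x.
Proof.
move=> x0; have ui := mul_pdf_upper_integrable ch lh.
apply: (@upper_unique _ (fun x => upper (fun u => h u * p u) x - h x * Pbar x)
  (fun u => dh u * upQ 0 u)); last exact: x0.
- exact: continuous_phi_upperQ.
- exact: fast_decay_phi_upperQ.
- move=> y y0.
  have d1 := is_deriveM_fun (hdh y0) (is_deriveN_gamma_ccdf a b0 y0).
  have d2 := is_derive_upper y0 (continuous_mul_pdf ch) ui.
  have d := is_deriveD_fun d2 d1.
  rewrite (_ : (fun _ => _) = fun x =>
      upper (fun u => h u * p u) x + h x * - Pbar x); last first.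
    by apply/funext => u; rewrite mulrN.
  refine (is_derive_eq d _).
  by rewrite upperQ0; ring.
- have f1 : fast_decay (upper (fun u => h u * p u)).
    apply: fast_decay_upper; first exact: continuous_mul_pdf.
    exact: fast_decay_mul_pdf.
  have f2 : fast_decay (fun x => h x * Pbar x).
    apply: fast_decayM; first exact: linear_growth_poly.
    exact: fast_decay_gamma_ccdf.
  by have := cvgB (fast_decay_cvg f1) (fast_decay_cvg f2); rewrite subr0; apply.
Qed.

Lemma An1_parts x : 0 < x -> A 0 h x = h x * loQ 1 x - A 1 dh x.
Proof.
move=> x0; apply: (@lower_unique _ (fun x => h x * loQ 1 x - A 1 dh x)
  (fun u => h u * loQ 0 u)); last exact: x0.
- exact: continuous_phi_lowerQ.
- exact: phi_lowerQ_integrable.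
- move=> y y0.
  have d1 := is_deriveM_fun (hdh y0) (is_derive_lowerQ a0 b0 0 y0).
  have d2 := is_derive_An a0 b0 cdh ldh 1 y0.
  refine (is_derive_eq (is_deriveB_fun d1 d2) _); ring.
- have h0 := linear_growthM_cvg0 lh (@lowerQ_cvg0 _ _ _ a0 b0 1).
  by have := cvgB h0 (@An_cvg0 _ _ _ a0 b0 _ cdh ldh 1); rewrite subr0; apply.
Qed.

Lemma Bn1_parts x : 0 < x -> B 0 h x = h x * upQ 1 x + B 1 dh x.
Proof.
move=> x0; apply: (@upper_unique _ (fun x => h x * upQ 1 x + B 1 dh x)
  (fun u => h u * upQ 0 u)); last exact: x0.
- exact: continuous_phi_upperQ.
- exact: fast_decay_phi_upperQ.
- move=> y y0.
  have d1 := is_deriveM_fun (hdh y0) (is_derive_upperQ a b0 0 y0).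
  have d2 := is_derive_Bn a b0 cdh ldh 1 y0.
  refine (is_derive_eq (is_deriveD_fun d1 d2) _); ring.
- have f := @fast_decay_phi_upperQ _ a _ b0 _ lh 1.
  have := cvgD (fast_decay_cvg f) (@Bn_cvg0 _ _ _ b0 _ cdh ldh 1).
  by rewrite addr0; apply.
Qed.

(** The boundary terms of the two integrations by parts combine by P + Pbar = 1. *)
Lemma An0B_Bn0 x : 0 < x -> A 0 dh x - B 0 dh x = h x - gamma_mean a b h.
Proof.
move=> x0; rewrite An0_parts// Bn0_parts// (gamma_meanE ch lh x0).
rewrite -[X in _ = X - _]mulr1 -(gamma_cdfD a0 b0 x0); ring.
Qed.

(** This gives the equality of the two forms of the function l: the boundary terms form h times the
    Wronskian of index 1, which is exactly -h(x) / (bx) after division. *)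
Lemma Vn_parts x : 0 < x -> V 0 2 h x + h x / (b * x) = V 1 2 dh x.
Proof.
move=> x0; rewrite /Vn An1_parts// Bn1_parts//.
have -> : h x / (b * x) =
    h x * (loQ 2 x * upQ 1 x + loQ 1 x * upQ 2 x) / dn 2 x.
  rewrite (wronskianQ a0 b0 1 x0) (denS _ _ 1) factS fact0 mul1n mul1r.
  have := lt0r_neq0 (den_gt0 a0 b0 1 x0); move: (dn 1 x) => d d0.
  by field; rewrite d0 !lt0r_neq0.
rewrite exprD; move: (loQ 2 x) (loQ 1 x) (upQ 1 x) (upQ 2 x) (dn 2 x)^-1.
by move=> q1 q2 q3 q4 d; ring.
Qed.

End integration_by_parts.

(** In the coefficients of [A] and [B] the parts with x - ab cancel by the formulas for Q_1 and
    Qbar_1; what remains is b x p divided by itself, up to sign. *)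
Lemma stein_equation_Vn phi x : 0 < x ->
  b * x * V 0 1 phi x - (x - a * b) * V 0 0 phi x = A 0 phi x - B 0 phi x.
Proof.
move=> x0; rewrite /Vn (denS _ _ 0) lowerQ1 upperQ1 lowerQ0 upperQ0.
have p0 := lt0r_neq0 (gamma_pdf_gt0 a0 b0 x0).
rewrite /den expr0 mulr1 addn0 addn1 expr0 expr1.
move: (A 0 phi x) (B 0 phi x) (P x) (Pbar x) (p x) p0 => ? ? ? ? d d0.
by field; rewrite d0 (lt0r_neq0 b0) (lt0r_neq0 x0).
Qed.

Lemma eq_bounded_pos F G : (forall x, 0 < x -> F x = G x) ->
  bounded_pos F -> bounded_pos G.
Proof.
move=> E /bounded_posP[C HC]; apply/bounded_posP; exists C => x x0.
by rewrite -E// HC.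
Qed.

Section bounds.
Variable phi : R -> R.
Hypotheses (cphi : continuous_pos phi)
  (phi1 : forall x, 0 < x -> `|phi x| <= 1).

Let lphi : linear_growth phi := le1_linear_growth phi1.

Lemma continuous_Vn j k : continuous_pos (V j k phi).
Proof.
move=> x x0; exact: is_derive_continuous (is_derive_Vn a0 b0 cphi lphi j k x0).
Qed.

Lemma Vn0_bounded j : bounded_pos (V j j phi).
Proof.
apply/bounded_posP; exists (j`!%:R / j.+1%:R) => x x0.
exact: Vn0_le.
Qed.

Lemma Vn1_bounded j : bounded_pos (V j j.+1 phi).
Proof.
apply: bounded_pos_ends; first exact: continuous_Vn.
  have [e [C [e0 HC]]] := Jn_right0 a0 b0 j.+1.
  exists e, (2 * C); split => // x x0 xe.
  apply: le_trans (Vn1_le a0 b0 cphi lphi phi1 j x0) _.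
  by rewrite ler_wpM2l// HC.
have [N [C HC]] := Jn_pinfty a0 b0 j.+1.
exists (Num.max N 1), (2 * C) => x x0; rewrite ge_max => /andP[Nx x1].
apply: le_trans (Vn1_le a0 b0 cphi lphi phi1 j x0) _; rewrite ler_wpM2l//.
apply: le_trans (HC x x0 Nx); rewrite ler_peMl//.
apply: divr_ge0; last exact/ltW/den_gt0.
by rewrite mulr_ge0 ?lowerQ_ge0 ?upperQ_ge0.
Qed.

Lemma mul_Vn1_bounded j : bounded_pos (fun x => x * V j j.+1 phi x).
Proof.
apply: bounded_pos_ends.
- move=> x x0; apply: continuousM; [exact: cvg_id|exact: continuous_Vn].
- have [e [C [e0 HC]]] := Jn_right0 a0 b0 j.+1.
  exists e, (e * (2 * C)); split => // x x0 xe.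
  rewrite normrM (gtr0_norm x0); apply: ler_pM => //; first exact: ltW.
  apply: le_trans (Vn1_le a0 b0 cphi lphi phi1 j x0) _.
  by rewrite ler_wpM2l// HC.
- have [N [C HC]] := Jn_pinfty a0 b0 j.+1.
  exists N, (2 * C) => x x0 Nx; rewrite normrM (gtr0_norm x0).
  apply: le_trans (ler_wpM2l (ltW x0) (Vn1_le a0 b0 cphi lphi phi1 j x0)) _.
  by rewrite mulrCA ler_wpM2l// HC.
Qed.

Lemma mul_Vn2_bounded j :
  bounded_pos (fun x => x * (V j j.+2 phi x + j`!%:R * (phi x / (b * x)))).
Proof.
(* One half comes from [Vn2_le], the other from |phi| <= 1 in the added term. *)
apply/bounded_posP; exists (2 * (j`!%:R / b)) => x x0.
have -> : 2 * (j`!%:R / b) = x * (j`!%:R / (b * x) + j`!%:R / (b * x)).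
  by field; rewrite !lt0r_neq0.
rewrite normrM (gtr0_norm x0) ler_wpM2l ?(ltW x0)//.
apply: le_trans (ler_normD _ _) _; apply: lerD; first exact: Vn2_le.
rewrite !normrM normfV (gtr0_norm (mulr_gt0 b0 x0)) ger0_norm//.
by rewrite ler_wpM2l// ler_piMl ?phi1// invr_ge0 mulr_ge0// ltW.
Qed.

Lemma continuous_mul_Vn2 j :
  continuous_pos (fun x => x * (V j j.+2 phi x + j`!%:R * (phi x / (b * x)))).
Proof.
move=> x x0; apply: continuousM; first exact: cvg_id.
apply: continuousD; first exact: continuous_Vn.
apply: continuousM; first exact: cvg_cst.
apply: continuousM; first exact: cphi.
apply: continuousV; first by rewrite mulf_neq0 ?lt0r_neq0.
by apply: continuousM; [exact: cvg_cst|exact: cvg_id].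
Qed.

End bounds.

End SteinEquation.

(** * Integrability of bounded functions, and assembly of the theorem *)

Lemma bounded_gamma_integrable (R : realType) (u v : R) (F : R -> R) :
  0 < u -> 0 < v -> continuous_pos F -> bounded_pos F -> gamma_integrable u v F.
Proof.
move=> u0 v0 cF /bounded_posP[C HC].
apply: linear_growth_gamma_integrable => //.
exists C => x x0; apply: le_trans (HC x x0) _.
rewrite ler_peMr//; first exact: le_trans (HC x x0).
by rewrite lerDl ltW.
Qed.

Unset Implicit Arguments.

Theorem lemma1p5 (R : realType) (a b : R) (ha : 0 < a) (hb : 0 < b) :
  (forall h : R -> R, classZ1 h ->
    (* the mean of h and the kernel formulas are well defined *)
    [/\ gamma_integrable a b h
        & forall (k : nat) (x : R), (k <= 2)%N -> 0 < x ->
            gamma_integrable a b (fun u => derive1 h u * kernel1 a b k u x)] /\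
    gamma_stein_solution a b h (stein_f a b h) /\
    (forall x : R, 0 < x ->
       is_derive x 1 (stein_f a b h) (stein_g a b h x) /\
       is_derive x 1 (stein_g a b h) (stein_l a b h x)) /\
    [/\ bounded_pos (stein_f a b h),
        bounded_pos (stein_g a b h),
        bounded_pos (fun x => x * stein_g a b h x)
        & bounded_pos (fun x => x * stein_l a b h x)] /\
    (forall u v : R, 0 < u -> 0 < v ->
      [/\ gamma_integrable u v (stein_f a b h),
          gamma_integrable u v (stein_g a b h),
          gamma_integrable u v (fun x => x * stein_g a b h x)
          & gamma_integrable u v (fun x => x * stein_l a b h x)])) /\
  (forall h : R -> R, classZ2 h ->
    (* the kernel formulas are well defined *)
    (forall x : R, 0 < x ->
       [/\ gamma_integrable a b (fun u => derive1 h u * kernel1 a b 2 u x),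
           gamma_integrable a b (fun u => derive1n 2 h u * kernel2 a b 2 u x)
           & gamma_integrable a b (fun u => derive1n 2 h u * kernel2 a b 3 u x)]) /\
    (forall x : R, 0 < x -> stein_l a b h x = stein_ltilde a b h x) /\
    (forall x : R, 0 < x ->
       is_derive x 1 (stein_l a b h) (stein_m a b h x)) /\
    (bounded_pos (stein_l a b h) /\
     bounded_pos (fun x => x * stein_m a b h x)) /\
    (forall u v : R, 0 < u -> 0 < v ->
       gamma_integrable u v (stein_l a b h) /\
       gamma_integrable u v (fun x => x * stein_m a b h x))).
Proof.
split=> h Zh.
  pose phi : R -> R := derive1 h.
  have hphi (x : R) : 0 < x -> is_derive x 1 h (phi x).
    by move=> /Zh[dh _ _]; apply: (DeriveDef dh); rewrite /phi derive1E.
  have cphi : continuous_pos phi by move=> x /Zh[].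
  have phi1 (x : R) : 0 < x -> `|phi x| <= 1 by move=> /Zh[].
  have lphi := le1_linear_growth phi1.
  have lh := derivative_le1_linear_growth hphi phi1.
  have ch : continuous_pos h.
    by move=> x x0; exact: is_derive_continuous (hphi x x0).
  have kmean k x := @kernel1_mean _ _ _ ha hb phi k x cphi lphi.
  have fE (x : R) : 0 < x -> Vn a b 0 0 phi x = stein_f a b h x.
    by move=> x0; have [_ <-] := kmean 0%N x x0.
  have gE (x : R) : 0 < x -> Vn a b 0 1 phi x = stein_g a b h x.
    by move=> x0; have [_ <-] := kmean 1%N x x0.
  have lE (x : R) : 0 < x ->
      Vn a b 0 2 phi x + 0`!%:R * (phi x / (b * x)) = stein_l a b h x.
    by move=> x0; have [_ <-] := kmean 2%N x x0; rewrite fact0 mul1r.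
  have df (x : R) : 0 < x -> is_derive x 1 (stein_f a b h) (stein_g a b h x).
    move=> x0; apply: (eq_is_derive_pos x0 fE); rewrite -(gE x x0).
    exact: is_derive_Vn0.
  have dg (x : R) : 0 < x -> is_derive x 1 (stein_g a b h) (stein_l a b h x).
    move=> x0; apply: (eq_is_derive_pos x0 gE); rewrite -(lE x x0).
    exact: is_derive_Vn1.
  have bf : bounded_pos (stein_f a b h).
    by apply: (eq_bounded_pos fE); exact: Vn0_bounded.
  have bg : bounded_pos (stein_g a b h).
    by apply: (eq_bounded_pos gE); exact: Vn1_bounded.
  have bxg : bounded_pos (fun x => x * stein_g a b h x).
    apply: (@eq_bounded_pos _ (fun x => x * Vn a b 0 1 phi x)).
      by move=> x x0; rewrite gE.
    exact: mul_Vn1_bounded.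
  have xlE (x : R) : 0 < x ->
      x * (Vn a b 0 2 phi x + 0`!%:R * (phi x / (b * x))) =
      x * stein_l a b h x.
    by move=> x0; rewrite lE.
  have bxl : bounded_pos (fun x => x * stein_l a b h x).
    by apply: (eq_bounded_pos xlE); exact: mul_Vn2_bounded.
  have cf : continuous_pos (stein_f a b h).
    by move=> x x0; exact: is_derive_continuous (df x x0).
  have cg : continuous_pos (stein_g a b h).
    by move=> x x0; exact: is_derive_continuous (dg x x0).
  split; last split; last split; last split.
  - split; first exact: linear_growth_gamma_integrable.
    by move=> k x _ x0; have [] := kmean k x x0.
  - split; first exact: bounded_derivative_AC df bg.
    (* As g is the derivative of f at every positive point, it is the version for which the equation
       holds everywhere. *)
    exists (stein_g a b h); first exact: aeW.
    move=> x x0; rewrite -(gE x x0) -(fE x x0) stein_equation_Vn//.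
    by rewrite (An0B_Bn0 ha hb hphi).
  - by move=> x x0; split; [exact: df|exact: dg].
  - by split.
  - move=> u v u0 v0; split; apply: bounded_gamma_integrable => //.
      by move=> x x0; apply: continuousM; [exact: cvg_id|exact: cg].
    by apply: (eq_continuous_pos xlE); exact: continuous_mul_Vn2.
pose phi : R -> R := derive1 h; pose psi : R -> R := derive1n 2 h.
have phipsi (x : R) : 0 < x -> is_derive x 1 phi (psi x).
  move=> /Zh[_ dh _ _]; apply: (DeriveDef dh).
  by rewrite /psi derive1nS derive1E derive1n1.
have cphi : continuous_pos phi.
  by move=> x x0; exact: is_derive_continuous (phipsi x x0).
have cpsi : continuous_pos psi by move=> x /Zh[].
have psi1 (x : R) : 0 < x -> `|psi x| <= 1 by move=> /Zh[].
have lpsi := le1_linear_growth psi1.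
(* Here h' need not be bounded, but linear growth suffices for the kernel means. *)
have lphi := derivative_le1_linear_growth phipsi psi1.
have k1mean k x := @kernel1_mean _ _ _ ha hb phi k x cphi lphi.
have k2mean k x := @kernel2_mean _ _ _ ha hb psi k x cpsi lpsi.
have tE (x : R) : 0 < x -> Vn a b 1 2 psi x = stein_ltilde a b h x.
  by move=> x0; have [_ <-] := k2mean 2%N x x0.
have lE (x : R) : 0 < x -> stein_l a b h x = stein_ltilde a b h x.
  move=> x0; rewrite -(tE x x0) -(Vn_parts ha hb phipsi)//.
  by have [_ <-] := k1mean 2%N x x0.
(* With j = 1 and h'' for h', l takes the place that g had for j = 0, so its derivative and its
   bound come from the same lemmas. *)
have VE (x : R) : 0 < x -> Vn a b 1 2 psi x = stein_l a b h x.
  by move=> x0; rewrite (lE x x0) tE.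
have mE (x : R) : 0 < x ->
    Vn a b 1 3 psi x + 1`!%:R * (psi x / (b * x)) = stein_m a b h x.
  move=> x0; have [_ <-] := k2mean 3%N x x0.
  by rewrite factS fact0 mul1n mul1r.
have dl (x : R) : 0 < x -> is_derive x 1 (stein_l a b h) (stein_m a b h x).
  move=> x0; apply: (eq_is_derive_pos x0 VE); rewrite -(mE x x0).
  exact: is_derive_Vn1.
have bl : bounded_pos (stein_l a b h).
  by apply: (eq_bounded_pos VE); exact: Vn1_bounded.
have xmE (x : R) : 0 < x ->
    x * (Vn a b 1 3 psi x + 1`!%:R * (psi x / (b * x))) =
    x * stein_m a b h x.
  by move=> x0; rewrite mE.
have bxm : bounded_pos (fun x => x * stein_m a b h x).
  by apply: (eq_bounded_pos xmE); exact: mul_Vn2_bounded.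
split; last split; last split; last split => //.
- move=> x x0; split.
  + by have [] := k1mean 2%N x x0.
  + by have [] := k2mean 2%N x x0.
  + by have [] := k2mean 3%N x x0.
- exact: lE.
- exact: dl.
- move=> u v u0 v0; split; apply: bounded_gamma_integrable => //.
    by move=> x x0; exact: is_derive_continuous (dl x x0).
  by apply: (eq_continuous_pos xmE); exact: continuous_mul_Vn2.
Qed.
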